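(* Let $\beta_1,\beta_2:\mathbb{CP}^1\to\mathbb{CP}^1$ be Belyi functions (in the sense of the context) such that $\beta_1^{-1}([-1,1])=\beta_2^{-1}([-1,1])$ as subsets of $\mathbb{CP}^1$, and such that $\mathbb{C}(\beta_1,\beta_2)=\mathbb{C}(z)$, i.e. $\beta_1$ and $\beta_2$ generate the whole field of rational functions $\mathbb{C}(z)$. Then either both dessins $\mathcal D_{\beta_1}$ and $\mathcal D_{\beta_2}$ are segments, or both $\mathcal D_{\beta_1}$ and $\mathcal D_{\beta_2}$ are circles.
   Context: A Belyi function is a non-constant rational function $\beta:\mathbb{CP}^1\to\mathbb{CP}^1$ ramified only over the points $-1,1,\infty$ (i.e. all its critical values lie in $\{-1,1,\infty\}$). The dessin $\mathcal D_\beta$ corresponding to $\beta$ is the set $\beta^{-1}([-1,1])\subset\mathbb{CP}^1$ considered as a bi-colored graph on the Riemann sphere whose white vertices are the points of $\beta^{-1}(\{-1\})$ and whose black vertices are the points of $\beta^{-1}(\{1\})$. The set $\beta^{-1}([-1,1])$ itself (without graph structure) is called the support of $\mathcal D_\beta$. A dessin is called a segment if its support is homeomorphic to a closed segment, and a circle if its support is homeomorphic to a circle. *)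

(* Defs.v *)
From HB Require Import structures.
From mathcomp Require Import all_boot all_order all_algebra.
From mathcomp Require Import all_classical all_reals all_analysis.
From mathcomp Require Import complex.
Set Implicit Arguments. Unset Strict Implicit. Unset Printing Implicit Defensive.
Import Order.TTheory GRing.Theory Num.Theory.
Import numFieldNormedType.Exports.
Local Open Scope ring_scope.
Local Open Scope classical_set_scope.

(* The Riemann sphere CP^1 = C u {oo}: [Some z] is the point z, [None] is oo. *)
Definition CP1 (R : realType) := option R[i].

(* Topology of CP^1: the one transported from the unit sphere S^2 in R^3
   through the inverse stereographic projection (oo |-> north pole). *)
Definition sphere_of (R : realType) (z : CP1 R) : R * R * R :=
  match z with
  | None => (1, 0, 0)
  | Some (Complex a b) =>
      let n := a ^+ 2 + b ^+ 2 in
      ((n - 1) / (n + 1), 2 * a / (n + 1), 2 * b / (n + 1))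
  end.

Record ratfun (R : realType) := RatFun {
  rf_num : {poly R[i]};
  rf_den : {poly R[i]} }.

Definition rf_deg (R : realType) (b : ratfun R) : nat :=
  maxn (size (rf_num b)).-1 (size (rf_den b)).-1.

Definition rf_wf (R : realType) (b : ratfun R) : Prop :=
  coprimep (rf_num b) (rf_den b) /\ rf_den b != 0.

Definition rf_eval (R : realType) (b : ratfun R) (z : CP1 R) : CP1 R :=
  let p := rf_num b in let q := rf_den b in
  match z with
  | Some x => if q.[x] != 0 then Some (p.[x] / q.[x]) else None
  | None =>
      if (size p < size q)%N then Some 0
      else if size p == size q then Some (lead_coef p / lead_coef q)
      else None
  end.

(* Local degree (ramification index) of b at a point z lying over a FINITE
   value w: for finite z it is the multiplicity of z as a root of p - w q
   (as b - w = (p - w q)/q with q(z) <> 0); at z = oo it is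
   deg b - deg (p - w q). *)
Definition locdeg (R : realType) (b : ratfun R) (w : R[i]) (z : CP1 R) : nat :=
  let r := rf_num b - w *: rf_den b in
  match z with
  | Some x => mup x r
  | None => (rf_deg b - (size r).-1)%N
  end.

Definition locdeg_inf (R : realType) (b : ratfun R) (z : CP1 R) : nat :=
  match z with
  | Some x => mup x (rf_den b)
  | None => ((size (rf_num b)).-1 - (size (rf_den b)).-1)%N
  end.

Definition critical_point (R : realType) (b : ratfun R) (z : CP1 R) : Prop :=
  match rf_eval b z with
  | Some w => (2 <= locdeg b w z)%N
  | None => (2 <= locdeg_inf b z)%N
  end.

Definition belyi (R : realType) (b : ratfun R) : Prop :=
  rf_wf b /\ (0 < rf_deg b)%N /\
  forall z : CP1 R, critical_point b z ->
    rf_eval b z \in [:: Some 1; Some (-1); None].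

Definition dessin_support (R : realType) (b : ratfun R) : set (CP1 R) :=
  [set z | exists x : R, -1 <= x <= 1 /\ rf_eval b z = Some (x%:C)%C].

Definition homeomorphic (X Y : topologicalType) (A : set X) (B : set Y) : Prop :=
  exists (f : X -> Y) (g : Y -> X),
    [/\ {in A, forall x, f x \in B}, {in B, forall y, g y \in A},
        {in A, cancel f g}, {in B, cancel g f} &
        {within A, continuous f} /\ {within B, continuous g}].

Definition R3 (R : realType) : topologicalType := (R * R * R)%type.

Definition CP1_homeomorphic (R : realType) (Y : topologicalType)
    (S : set (CP1 R)) (B : set Y) : Prop :=
  @homeomorphic (R3 R) Y
    (sphere_of (R := R) @` S) B.

Definition unit_segment (R : realType) : set R := `[0, 1]%classic.
Definition unit_circle (R : realType) : set (R * R) :=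
  [set p | p.1 ^+ 2 + p.2 ^+ 2 = 1].

Definition is_segment (R : realType) (b : ratfun R) : Prop :=
  CP1_homeomorphic (dessin_support b) (@unit_segment R).
Definition is_circle (R : realType) (b : ratfun R) : Prop :=
  CP1_homeomorphic (dessin_support b) (@unit_circle R).

Notation "x %:F" := (@FracField.tofrac _ x).

Definition rf_frac (R : realType) (b : ratfun R) : {fraction {poly R[i]}} :=
  (rf_num b)%:F / (rf_den b)%:F.

Definition eval2 (R : realType) (P : {poly {poly R[i]}})
    (u v : {fraction {poly R[i]}}) : {fraction {poly R[i]}} :=
  \sum_(i < size P) (\sum_(j < size P`_i) ((P`_i`_j)%:P)%:F * v ^+ j) * u ^+ i.

(* C(b1, b2) = C(z): the generator z lies in the subfield generated over C by
   b1 and b2, i.e. z = P(b1,b2)/Q(b1,b2) with Q(b1,b2) <> 0. *)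
Definition generate_Cz (R : realType) (b1 b2 : ratfun R) : Prop :=
  exists P Q : {poly {poly R[i]}},
    eval2 Q (rf_frac b1) (rf_frac b2) != 0 /\
    ('X)%:F = eval2 P (rf_frac b1) (rf_frac b2) / eval2 Q (rf_frac b1) (rf_frac b2).

(* Main.v *)
(* The two functions are real on the common support K, and the coordinate z is
   a rational function of them; conjugating coefficients, the conjugate of z is
   a rational function N(z)/D(z) on K minus a finite set.  For such z the
   polynomial N - conj(z) D has z as its only root, so N/D has degree 1 and K
   lies, up to finitely many points, on a circle of the sphere; since K is the
   zero locus of p - c q, c in [-1,1], all roots of which depend continuously on
   c, K lies on the circle S entirely.  If K = S we are done.

   Otherwise choose the coordinate so that S is the real line and infinity is a
   generic point of S \ K.  Then b1 = p/q with p, q real of degree n, K is the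
   set where p^2 <= q^2, and p has n simple zeros, all real.  Between two zeros
   of p there is a root of p^2 - q^2 (otherwise Rolle gives a critical value in
   (-1,1)), and Riemann-Hurwitz bounds the number of roots of p^2 - q^2 by n+1.
   Any gap in K would produce one root too many, so K is an interval. *)
Require Import Defs.
From HB Require Import structures.
From mathcomp Require Import all_boot all_order all_algebra.
From mathcomp Require Import all_classical all_reals all_analysis.
From mathcomp Require Import complex.
From mathcomp Require Import polyrcf zify ring lra.
Set Implicit Arguments. Unset Strict Implicit. Unset Printing Implicit Defensive.
Import Order.TTheory GRing.Theory Num.Theory.
Import numFieldNormedType.Exports.
Local Open Scope ring_scope.

(** * Wronskians and homogenisation *)

(** Infinity shapes the argument: b(z) = w is read everywhere as the vanishing at z of p - w q,
    taken as a form of degree n, with infinity a zero when the coefficient of degree n vanishes.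
    [hcomp] carries this reading through a Moebius coordinate, and ramification is read off the
    Wronskian, whose degree 2n - 2 records that infinity is unramified. The expression of z through
    b1 and b2 breaks down at finitely many points, so the circle equation is first obtained off the
    zeros of an auxiliary polynomial, which the fibres over all but finitely many real c avoid.
    Continuity of roots takes the form of an explicit estimate comparing a real-rooted polynomial at
    a nonreal and at a real point. Two centres are sent to infinity in turn: first a point of K,
    available before anything is known of its complement in the circle, and then a point off K, as
    the interval argument requires. That N - conj(z) D has a single root comes from conjugation
    being an involution. *)

(** Numerator of the derivative of p/q: its roots off the zeros of q are the finite critical points
    that are not poles. *)
Definition wronsk (F : comNzRingType) (p q : {poly F}) : {poly F} :=
  p^`() * q - p * q^`().

Lemma wronskBl (F : comNzRingType) (w : F) (p q : {poly F}) :
  wronsk (p - w *: q) q = wronsk p q.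
Proof. by rewrite /wronsk derivB derivZ -!mul_polyC; ring. Qed.

Lemma wronskN (F : comNzRingType) (p q : {poly F}) : wronsk q p = - wronsk p q.
Proof. by rewrite /wronsk; ring. Qed.

Lemma wronskZ (F : comNzRingType) (k l : F) (p q : {poly F}) :
  wronsk (k *: p) (l *: q) = (k * l) *: wronsk p q.
Proof. by rewrite /wronsk !derivZ -!mul_polyC polyCM; ring. Qed.

Section ClosedField.
Variable F : numClosedFieldType.
Implicit Types p q r : {poly F}.

Lemma coprimep_noroot p q :
  reflect (forall x, root p x -> ~~ root q x) (coprimep p q).
Proof.
rewrite coprimep_def; apply: (iffP idP) => [|h].
  move=> h x px; apply/negP => qx; apply/negP: h.
  by apply/closed_rootP; exists x; rewrite root_gcd px.
apply/negPn/negP => /closed_rootP[x]; rewrite root_gcd => /andP[px qx].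
by have := h x px; rewrite qx.
Qed.

(** Over an algebraically closed field the degree counts roots with multiplicity; this turns local
    ramification data into a global count. *)
Lemma eq_size_mup p q : p != 0 -> q != 0 ->
  (forall x, mup x p = mup x q) -> size p = size q.
Proof.
move=> p0 q0 h.
have [rp ep] := closed_field_poly_normal p.
have [rq eq] := closed_field_poly_normal q.
have lp : lead_coef p != 0 by rewrite lead_coef_eq0.
have lq : lead_coef q != 0 by rewrite lead_coef_eq0.
suff /perm_size e : perm_eq rp rq.
  by rewrite ep eq !size_scale // !size_prod_XsubC e.
apply/allP => x _ /=; apply/eqP; rewrite -!mu_prod_XsubC.
have hs (k : F) r : k != 0 -> mup x (k *: r) = mup x r.
  by move=> k0; rewrite -mul_polyC mupMr // rootC.
by have := h x; rewrite ep eq !hs.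
Qed.

(** With p = g (X - x)^(m+1), the Wronskian is (X - x)^m times a factor whose value at x is (m+1)
    g(x) q(x), nonzero in characteristic 0. *)
Lemma mup_wronsk p q x : p != 0 -> root p x -> ~~ root q x ->
  (mup x (wronsk p q)).+1 = mup x p.
Proof.
move=> p0 px qx; have [[|m] [g]] := multiplicity_XsubC p x; rewrite p0 /=.
  by move=> gx e; move: px; rewrite e expr0 mulr1 (negPf gx).
move=> gx ->; rewrite [RHS]mupMr // mup_XsubCX eqxx; congr S.
have -> : wronsk (g * ('X - x%:P) ^+ m.+1) q =
    (g^`() * ('X - x%:P) * q + g * q *+ m.+1 - g * ('X - x%:P) * q^`())
    * ('X - x%:P) ^+ m.
  rewrite /wronsk derivM deriv_exp derivXsubC mul1r exprS -pred_Sn.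
  by rewrite -[_ *+ m.+1]mulr_natr -[g * q *+ m.+1]mulr_natr; ring.
rewrite mupMr ?mup_XsubCX ?eqxx //.
rewrite rootE !hornerE subrr !(mulr0, mul0r) subr0 add0r hornerMn hornerM.
by rewrite mulrn_eq0 /= mulf_neq0 // -rootE.
Qed.

(* Riemann-Hurwitz: the polynomials wronsk p q * \prod_(z in Z) ('X - z) and
   (p^2 - q^2) q have the same multiplicities, hence the same degree.  The
   hypotheses on sizes say that infinity is a generic point. *)
Lemma riemann_hurwitz_count p q n : (0 < n)%N -> coprimep p q ->
  size (p - q) = n.+1 -> size (p + q) = n.+1 -> size q = n.+1 ->
  size (wronsk p q) = (n.*2).-1 ->
  (forall x, root (wronsk p q) x -> ~~ root q x -> root ((p - q) * (p + q)) x) ->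
  exists Z : seq F, [/\ uniq Z, size Z = n.+2 &
    forall x, (x \in Z) = root ((p - q) * (p + q) * q) x].
Proof.
move=> n0 /coprimep_noroot cpq s1 s2 s3 sW hW.
set A := (p - q) * (p + q) * q.
have nz r k : size r = k.+1 -> r != 0 by rewrite -size_poly_eq0 => ->.
have [[p1 p2] p3] := (nz _ _ s1, nz _ _ s2, nz _ _ s3).
have W0 : wronsk p q != 0.
  by move: sW; case: (n) n0 => // k _; rewrite doubleS => /nz.
have A0 : A != 0 by rewrite !mulf_neq0.
have sA : size A = (3 * n).+1.
  rewrite size_mul ?mulf_neq0 // size_mul // s1 s2 s3; lia.
have [rs eA] := closed_field_poly_normal A.
have lA : lead_coef A != 0 by rewrite lead_coef_eq0.
pose Z := undup rs; pose T := \prod_(z <- Z) ('X - z%:P).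
have ZP x : (x \in Z) = root A x.
  by rewrite mem_undup eA rootZ // root_prod_XsubC.
have uZ : uniq Z by exact: undup_uniq.
have T0 : T != 0 by rewrite monic_neq0 // monic_prod_XsubC.
exists Z; split=> //.
(* In degrees: 3n = (2n - 2) + |Z|, hence |Z| = n + 2. *)
suff : size A = size (wronsk p q * T).
  rewrite sA size_mul // sW size_prod_XsubC -/Z -muln2; move: (size Z) n0 => sZ; lia.
apply: eq_size_mup => //; first by rewrite mulf_neq0.
move=> x; rewrite [RHS]mupM // mu_prod_XsubC count_uniq_mem // ZP.
have [|nAx] := boolP (root A x); last first.
  rewrite [LHS]mupNroot // mupNroot //; apply: contra nAx => Wx.
  rewrite /A rootM; case: (boolP (root q x)) => [_|qx]; first by rewrite orbT.
  by rewrite hW.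
rewrite addn1 /A.
(* A pole is a zero of q/p, whose Wronskian is the same up to sign. *)
have [qx _|qx] := boolP (root q x).
  have px : ~~ root p x by apply: contraL qx; exact: cpq.
  have h1 : ~~ root (p - q) x.
    by move: qx px; rewrite !rootE !hornerE => /eqP ->; rewrite subr0.
  have h2 : ~~ root (p + q) x.
    by move: qx px; rewrite !rootE !hornerE => /eqP ->; rewrite addr0.
  rewrite mupMr ?rootM ?negb_or ?h1 // -(@mup_wronsk q p) // wronskN.
  by rewrite -scaleN1r -mul_polyC mupMr // rootC oppr_eq0 oner_eq0.
rewrite rootM (negPf qx) orbF rootM mupMl //.
have [h1 _|h1 /= h2] := boolP (root (p - q) x).
  rewrite mupMl; last first.
    move: h1 qx; rewrite !rootE !hornerE subr_eq0 => /eqP ->.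
    by rewrite -mulr2n mulrn_eq0.
  by rewrite -(@mup_wronsk (p - q) q) // /wronsk derivB; congr (mup _ _).+1; ring.
rewrite mupMr // -(@mup_wronsk (p + q) q) //.
by rewrite /wronsk derivD; congr (mup _ _).+1; ring.
Qed.

End ClosedField.

(** * Homogeneous substitution in polynomials *)

Section Homog.
Variable F : fieldType.
Implicit Types p q r N D : {poly F}.

(* D^n r(N/D): the degree-n homogenisation of r evaluated at (N, D). *)
Definition hcomp n r N D : {poly F} :=
  \sum_(i < n.+1) r`_i *: (N ^+ i * D ^+ (n - i)).

Lemma hcompD n r s N D : hcomp n (r + s) N D = hcomp n r N D + hcomp n s N D.
Proof.
by rewrite /hcomp -big_split; apply: eq_bigr => i _; rewrite coefD scalerDl.
Qed.

Lemma hcompZ n (k : F) r N D : hcomp n (k *: r) N D = k *: hcomp n r N D.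
Proof.
by rewrite /hcomp scaler_sumr; apply: eq_bigr => i _; rewrite coefZ scalerA.
Qed.

Lemma hcompB n (k : F) r s N D :
  hcomp n (r - k *: s) N D = hcomp n r N D - k *: hcomp n s N D.
Proof. by rewrite -scaleNr hcompD hcompZ scaleNr. Qed.

Lemma hcompX n r N D : hcomp n.+1 ('X * r) N D = N * hcomp n r N D.
Proof.
rewrite /hcomp big_ord_recl mulr_sumr coefXM scale0r add0r.
by apply: eq_bigr => i _; rewrite coefXM /= -scalerAr mulrA -exprS subSS.
Qed.

Lemma hcompS n r N D : (size r <= n.+1)%N ->
  hcomp n.+1 r N D = D * hcomp n r N D.
Proof.
move=> sr; rewrite /hcomp big_ord_recr /= nth_default // scale0r addr0.
rewrite mulr_sumr; apply: eq_bigr => i _.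
by rewrite -scalerAr mulrCA -exprS subSn // -ltnS.
Qed.

(** A root x of r becomes the linear factor N - x D, so multiplicities can be followed through the
    substitution. *)
Lemma hcomp_XsubC n x r N D : (size r <= n.+1)%N ->
  hcomp n.+1 (('X - x%:P) * r) N D = (N - x *: D) * hcomp n r N D.
Proof.
by move=> sr; rewrite mulrBl mul_polyC hcompB hcompX hcompS // mulrBl scalerAl.
Qed.

Lemma horner_hcomp n r N D t : (size r <= n.+1)%N -> D.[t] != 0 ->
  (hcomp n r N D).[t] = D.[t] ^+ n * r.[N.[t] / D.[t]].
Proof.
move=> sr Dt; rewrite /hcomp horner_sum (horner_coef_wide _ sr) mulr_sumr.
apply: eq_bigr => i _; have le_in : (i <= n)%N by rewrite -ltnS.
have eDn : D.[t] ^+ n = D.[t] ^+ (n - i) * D.[t] ^+ i by rewrite -exprD subnK.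
rewrite hornerZ hornerM !horner_exp expr_div_n eDn.
move: (expf_neq0 i Dt); move: (D.[t] ^+ i) (D.[t] ^+ (n - i)) => u v u0.
by field.
Qed.

Lemma horner_hcomp0 n r N D t : D.[t] = 0 ->
  (hcomp n r N D).[t] = r`_n * N.[t] ^+ n.
Proof.
move=> Dt; rewrite /hcomp horner_sum big_ord_recr big1 /= => [|i _].
  by rewrite add0r subnn expr0 mulr1 hornerZ horner_exp.
by rewrite hornerZ hornerM !horner_exp Dt expr0n subn_eq0 leqNgt ltn_ord !mulr0.
Qed.

End Homog.

(** * Real zeros and critical points *)

Section Separated.
Variables (d : Order.disp_t) (T : orderType d).
Implicit Types (S Z : seq T).

(** Consecutive points of S bound disjoint gaps, each holding its own element of Z. *)
Lemma size_le_separators S Z : uniq S -> uniq Z ->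
  (forall u v, u \in S -> v \in S -> (u < v)%O -> exists2 z, z \in Z & (u < z < v)%O) ->
  (size S <= (size Z).+1)%N.
Proof.
move=> uS uZ h.
have : sorted <%O (sort <=%O S) by rewrite sort_lt_sorted.
have hs u v : u \in sort <=%O S -> v \in sort <=%O S -> (u < v)%O ->
    exists2 z, z \in Z & (u < z < v)%O by rewrite !mem_sort; exact: h.
rewrite -(size_sort <=%O); case: (sort <=%O S) hs => //= x s hs px.
(* The induction needs the sharper bound that counts only separators to the right of the least
   point. *)
apply: (@leq_trans (size [seq z <- Z | (x < z)%O]).+1); last first.
  by rewrite ltnS size_filter count_size.
rewrite ltnS; elim: s x px hs => [//|y s IH] x /= /andP[xy ys] hs.
have [||z zZ /andP[xz zy]] := hs x y _ _ xy.
- by rewrite inE eqxx.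
- by rewrite !inE eqxx orbT.
have {}IH : (size s <= size [seq z <- Z | (y < z)%O])%N.
  by apply: IH => // u v us vs; apply: hs; rewrite inE ?us ?vs orbT.
apply: leq_ltn_trans IH _.
apply: (@uniq_leq_size _ (z :: _)) => /= [|w].
  by rewrite filter_uniq // mem_filter ltNge (ltW zy).
rewrite inE !mem_filter => /predU1P[->|/andP[yw ->]]; first by rewrite xz.
by rewrite (lt_trans xy yw).
Qed.

Lemma exists_seq_min (s : seq T) x0 : x0 \in s ->
  exists2 m, m \in s & forall y, y \in s -> (m <= y)%O.
Proof.
elim: s x0 => // a [|b s] IH x0 _.
  by exists a; rewrite ?inE // => y; rewrite inE => /eqP ->.
have [|m ms hm] := IH b; first by rewrite inE eqxx.
have [am|ma] := leP a m.
  exists a; first by rewrite inE eqxx.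
  by move=> y; rewrite inE => /predU1P[->//|/hm]; exact: le_trans.
exists m; first by rewrite inE ms orbT.
by move=> y; rewrite inE => /predU1P[->|/hm//]; exact: ltW.
Qed.

End Separated.

Section Polynomial.
Variable R : rcfType.

Lemma exists_lt_all (s : seq R) : exists B, forall x, x \in s -> B < x.
Proof.
elim: s => [|a s [B hB]]; first by exists 0.
exists (Num.min B (a - 1)) => x; rewrite inE => /predU1P[->|/hB Bx].
  by rewrite gt_min; apply/orP; right; lra.
by rewrite gt_min Bx.
Qed.

Lemma horner_gt0_pinfty (A : {poly R}) (s : seq R) : 0 < lead_coef A ->
  exists U, 0 < A.[U] /\ forall x, x \in s -> x < U.
Proof.
move=> lA; have [N hN] := poly_pinfty_gt_lc lA.
have [B hB] := exists_lt_all (map -%R s).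
exists (Num.max N (- B)); split.
  by apply: (lt_le_trans lA); apply: hN; rewrite le_max lexx.
by move=> x xs; rewrite lt_max ltrNr hB ?orbT // map_f.
Qed.

Lemma horner_gt0_minfty (A : {poly R}) (s : seq R) : 0 < lead_coef A ->
  odd (size A) -> exists L, 0 < A.[L] /\ forall x, x \in s -> L < x.
Proof.
move=> lA oA; have [|U [AU hU]] := @horner_gt0_pinfty (A \Po (- 'X)) (map -%R s).
  rewrite lead_coef_comp ?size_polyN ?size_polyX // lead_coefN lead_coefX.
  have A0 : (0 < size A)%N by rewrite lt0n size_poly_eq0 -lead_coef_eq0 gt_eqF.
  move: oA; rewrite -(prednK A0) /= => /negPf e.
  by rewrite -signr_odd e mulr1.
exists (- U); split; first by move: AU; rewrite horner_comp !hornerE.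
by move=> x xs; rewrite ltrNl hU // map_f.
Qed.

End Polynomial.

Lemma horner_sqrB (R : comNzRingType) (p q : {poly R}) t :
  ((p - q) * (p + q)).[t] = p.[t] ^+ 2 - q.[t] ^+ 2.
Proof. by rewrite hornerM hornerD hornerN hornerD; ring. Qed.

Section Rolle.
Variable R : realType.
Implicit Types p q : {poly R}.

(** Rolle's theorem for p/q, whose derivative is the Wronskian over q^2. *)
Lemma wronsk_Rolle p q (a b : R) : a < b -> p.[a] = 0 -> p.[b] = 0 ->
  (forall x, a <= x <= b -> q.[x] != 0) ->
  exists2 c, a < c < b & (wronsk p q).[c] = 0.
Proof.
move=> ab pa pb hq.
have der x : a <= x <= b -> is_derive x 1 (fun y => p.[y] / q.[y])
    ((wronsk p q).[x] / q.[x] ^+ 2).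
  move=> xab; have qx := hq _ xab.
  have -> : (fun y => p.[y] / q.[y]) = horner p * (fun y => (horner q y)^-1).
    by [].
  have := is_deriveM (is_derive_poly p x) (is_deriveV qx (is_derive_poly q x)).
  move=> /trigger_derive; apply.
  rewrite /wronsk !hornerE /GRing.scale /=; field; exact: qx.
have [|||c cab dc] := @Rolle R (fun y => p.[y] / q.[y]) a b ab.
- move=> x; rewrite in_itv /= => /andP[ax xb].
  have /der : a <= x <= b by rewrite !ltW.
  by move=> [].
- apply: derivable_within_continuous => x; rewrite in_itv /= => /der.
  by move=> [].
- by rewrite pa pb !mul0r.
move: cab; rewrite in_itv /= => cab; exists c => //.
have cab' : a <= c <= b by case/andP: cab => *; rewrite !ltW.
have [_ d1] := der _ cab'; have [_ d2] := dc.
move: d1; rewrite d2 => /esym/eqP; rewrite mulf_eq0 invr_eq0 expf_eq0 /=.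
by rewrite (negPf (hq _ cab')) orbF => /eqP.
Qed.

End Rolle.

(** * Real functions p/q with infinity outside the support *)

Section Interval.
Variable R : realType.
Local Notation C := R[i].
Local Notation toC := (real_complex R).
Variables (p q : {poly R}) (n : nat).
Local Notation P := (map_poly toC p).
Local Notation Q := (map_poly toC q).
Local Notation A := ((p - q) * (p + q)).
Local Notation AC := ((P - Q) * (P + Q)).
(** Infinity is off the support ([lt_pq]), not a pole ([sq]) and not critical ([sW]); at finite
    critical points that are not poles, [unram] allows only the values 1 and -1. *)
Hypotheses (n_gt0 : (0 < n)%N) (cpq : coprimep P Q).
Hypotheses (sp : (size p <= n.+1)%N) (sq : size q = n.+1).
Hypothesis (lt_pq : q`_n ^+ 2 < p`_n ^+ 2).
Hypothesis (p_real : forall t, root P t -> complex.Im t = 0).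
Hypothesis (sW : size (wronsk P Q) = (n.*2).-1).
Hypothesis (unram : forall t, root (wronsk P Q) t -> ~~ root Q t -> root AC t).

(** The top coefficients cannot cancel: |k q_n| <= |q_n| < |p_n|. *)
Lemma size_comb k : `|k| <= 1 -> size (p - k *: q) = n.+1.
Proof.
move=> k1; apply/eqP; rewrite eqn_leq; apply/andP; split.
  rewrite (leq_trans (size_polyD _ _)) // geq_max sp size_polyN.
  by rewrite (leq_trans (size_scale_leq _ _)) ?sq.
rewrite ltnNge; apply/negP => /leq_sizeP/(_ n (leqnn _)).
rewrite coefB coefZ => /eqP; rewrite subr_eq0 => /eqP e.
move: lt_pq; rewrite e exprMn ltNge => /negP; apply.
rewrite -{2}[q`_n ^+ 2]mul1r ler_wpM2r ?sqr_ge0 //.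
by rewrite -real_normK ?num_real // expr_le1.
Qed.

Lemma map_A : map_poly toC A = AC.
Proof. by rewrite rmorphM rmorphB rmorphD. Qed.

Lemma horner_toC (r : {poly R}) x : (map_poly toC r).[toC x] = toC r.[x].
Proof. exact: horner_map. Qed.

Lemma root_toC (r : {poly R}) x : root (map_poly toC r) (toC x) = root r x.
Proof. by rewrite !rootE horner_toC -[0]/(toC 0) (inj_eq (@complexI R)). Qed.

Lemma wronsk_toC : wronsk P Q = map_poly toC (wronsk p q).
Proof. by rewrite /wronsk rmorphB !rmorphM !deriv_map. Qed.

Lemma size_toC (r : {poly R}) : size (map_poly toC r) = size r.
Proof. exact: size_map_poly. Qed.

Lemma size_pD : size (p + q) = n.+1.
Proof. by have := @size_comb (-1); rewrite normrN1 scaleN1r opprK; apply. Qed.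

Lemma size_pB : size (p - q) = n.+1.
Proof. by have := @size_comb 1; rewrite normr1 scale1r; apply. Qed.

Lemma size_p : size p = n.+1.
Proof. by have := @size_comb 0; rewrite normr0 scale0r subr0; apply; exact: ler01. Qed.

Lemma lead_A_gt0 : 0 < lead_coef A.
Proof.
rewrite lead_coefM !lead_coefE size_pD size_pB /= coefB coefD.
by rewrite -subr_sqr subr_gt0.
Qed.

(** The degree 2n is even, so that A, with its positive leading coefficient, is positive towards
    both ends of the line. *)
Lemma odd_size_A : odd (size A).
Proof.
have [pD pB] : p + q != 0 /\ p - q != 0.
  by rewrite -!size_poly_eq0 size_pD size_pB.
rewrite size_mul // size_pD size_pB addSn /= addnS /= oddD; by case: odd.
Qed.

Lemma exists_real_zeros : exists xs : seq R,
  [/\ uniq xs, size xs = n & forall x, x \in xs -> root p x /\ A.[x] < 0].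
Proof.
have P0 : P != 0 by rewrite -size_poly_eq0 size_toC size_p.
have lP : lead_coef P != 0 by rewrite lead_coef_eq0.
have [rs eP] := closed_field_poly_normal P.
have rootP z : (z \in rs) = root P z by rewrite eP rootZ // root_prod_XsubC.
have srs : size rs = n.
  have := size_p; rewrite -size_toC eP size_scale // size_prod_XsubC.
  by case.
(* A multiple zero of P would be a root of the Wronskian, hence of A by [unram]; but there A = -Q^2,
   which is nonzero by coprimality. *)
have urs : uniq rs.
  apply: count_mem_uniq => z; rewrite -mu_prod_XsubC.
  have -> : mup z (\prod_(y <- rs) ('X - y%:P)) = mup z P.
    by rewrite [in RHS]eP -mul_polyC mupMr // rootC.
  rewrite rootP; have [Pz|/mupNroot -> //] := boolP (root P z).
  have Qz := (coprimep_noroot _ _ cpq) _ Pz.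
  rewrite -(mup_wronsk P0 Pz Qz) mupNroot //; apply/negP => /unram.
  move=> /(_ Qz); rewrite rootE horner_sqrB (eqP Pz) expr0n sub0r oppr_eq0.
  by rewrite expf_eq0 /= -rootE (negPf Qz).
have Re_rs z : z \in rs -> z = toC (complex.Re z).
  by rewrite rootP => /p_real; case: z => a b /= ->.
exists [seq complex.Re z | z <- rs]; split; rewrite ?size_map //.
  rewrite map_inj_in_uniq // => z w /Re_rs -> /Re_rs -> /=.
  by move=> ->.
move=> x /mapP[z zrs ->].
have Pz : root P z by rewrite -rootP.
have Qz := coprimep_noroot _ _ cpq _ Pz.
move: Pz Qz; rewrite (Re_rs _ zrs) !root_toC /= => px qx; split=> //.
by rewrite horner_sqrB (eqP px) expr0n sub0r oppr_lt0 exprn_even_gt0.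
Qed.

(** Among the n + 2 points of the Riemann-Hurwitz count at least one is a pole, which is not a root
    of A; at most n + 1 remain. *)
Lemma exists_real_roots : exists V : seq R,
  [/\ uniq V, (size V <= n.+1)%N & forall x, (x \in V) = root A x].
Proof.
have [|||Z [uZ sZ ZP]] := riemann_hurwitz_count n_gt0 cpq _ _ _ sW unram.
- by rewrite -rmorphB size_toC size_pB.
- by rewrite -rmorphD size_toC size_pD.
- by rewrite size_toC.
have [|z Qz] := closed_rootP Q _.
  by rewrite size_toC sq eqSS -lt0n.
have nAz : ~~ root AC z.
  rewrite rootE horner_sqrB (eqP Qz) expr0n subr0 expf_eq0 /=.
  by apply: contraL Qz => pz; exact: (coprimep_noroot _ _ cpq).
pose V := undup [seq x <- [seq complex.Re z | z <- [seq z <- Z | root AC z]] | root A x].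
exists V; split; first exact: undup_uniq.
  rewrite (leq_trans (size_undup _)) // size_filter (leq_trans (count_size _ _)) //.
  rewrite size_map size_filter -ltnS -sZ -[ltnRHS](count_predC (root AC)).
  rewrite -{1}[count _ _]addn0 ltn_add2l -has_count; apply/hasP; exists z => //.
  by rewrite ZP rootM Qz orbT.
move=> x; rewrite mem_undup mem_filter; case: (boolP (root A x)) => //= Ax.
have ACx : root AC (toC x) by rewrite -map_A root_toC.
apply/mapP; exists (toC x) => //.
by rewrite mem_filter ACx ZP rootM ACx.
Qed.

Lemma root_between u v : u < v -> A.[u] * A.[v] < 0 ->
  exists2 z, root A z & u < z < v.
Proof.
move=> uv /(poly_ivtoo (ltW uv))[z]; rewrite in_itv /= => zuv Az.
by exists z.
Qed.

(** Without a root of A in between, A <= 0 on [u, v], so q cannot vanish there (p would vanish too).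
    Rolle then gives a critical point, which [unram] makes a root of A after all. *)
Lemma root_between_zeros u v : u < v -> root p u -> root p v ->
  exists2 z, root A z & u < z < v.
Proof.
move=> uv pu pv; apply: contrapT => noroot.
have Au w : root p w -> A.[w] <= 0.
  by move=> /rootP pw; rewrite horner_sqrB pw expr0n sub0r oppr_le0 sqr_ge0.
have Aneg x : u <= x <= v -> A.[x] <= 0.
  move=> /andP[]; rewrite le_eqVlt => /predU1P[<- _|ux]; first exact: Au.
  rewrite le_eqVlt => /predU1P[->|xv]; first exact: Au.
  rewrite leNgt; apply/negP => Ax; have Apu := Au _ pu.
  have Auneg : A.[u] < 0.
    rewrite lt_neqAle Apu andbT horner_sqrB (rootP pu) expr0n sub0r oppr_eq0.
    rewrite expf_eq0 /= -rootE -root_toC.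
    by apply: (coprimep_noroot _ _ cpq); rewrite root_toC.
  have [|z Az /andP[uz zx]] := root_between ux; first by rewrite nmulr_rlt0.
  by apply: noroot; exists z => //; rewrite uz (lt_trans zx).
have q0 x : u <= x <= v -> q.[x] != 0.
  move=> /Aneg; rewrite horner_sqrB => Ax; apply/eqP => qx.
  move: Ax; rewrite qx expr0n subr0 => px.
  have {}px : root p x.
    by have := le_anti (introT andP (conj px (sqr_ge0 _))) => /eqP; rewrite expf_eq0.
  have := coprimep_noroot _ _ cpq (toC x).
  by rewrite !root_toC px rootE qx eqxx => /(_ isT).
have [c uvc Wc] := wronsk_Rolle uv (rootP pu) (rootP pv) q0.
apply: noroot; exists c => //; rewrite -root_toC map_A; apply: unram.
  by rewrite wronsk_toC root_toC rootE Wc.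
by rewrite root_toC rootE q0 //; case/andP: uvc => *; rewrite !ltW.
Qed.

Lemma real_interval : exists t0 t1 : R, t0 < t1 /\
  forall t, (p.[t] ^+ 2 <= q.[t] ^+ 2) = (t0 <= t <= t1).
Proof.
have [xs [uxs sxs hxs]] := exists_real_zeros.
have [V [uV sV hV]] := exists_real_roots.
have AE t : (p.[t] ^+ 2 <= q.[t] ^+ 2) = (A.[t] <= 0).
  by rewrite horner_sqrB subr_le0.
(* A is positive far to the left, so a point with A <= 0 has a root of A at it or to its left; [s]
   lists further points that L must precede. *)
have below t s : A.[t] <= 0 ->
    exists L, [/\ 0 < A.[L], forall x, x \in t :: s -> L < x &
      exists2 z, root A z & L < z <= t].
  move=> At; have [L [AL hL]] := horner_gt0_minfty (t :: s) lead_A_gt0 odd_size_A.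
  exists L; split=> //.
  have Lt : L < t by rewrite hL // inE eqxx.
  move: At; rewrite le_eqVlt => /predU1P[At|At].
    by exists t; rewrite ?Lt ?lexx // rootE At.
  have [|z Az /andP[Lz zt]] := root_between Lt; first by rewrite pmulr_rlt0.
  by exists z => //; rewrite Lz ltW.
have above t s : A.[t] <= 0 ->
    exists U, [/\ 0 < A.[U], forall x, x \in t :: s -> x < U &
      exists2 z, root A z & t <= z < U].
  move=> At; have [U [AU hU]] := horner_gt0_pinfty (t :: s) lead_A_gt0.
  exists U; split=> //.
  have tU : t < U by rewrite hU // inE eqxx.
  move: At; rewrite le_eqVlt => /predU1P[At|At].
    by exists t; rewrite ?tU ?lexx // rootE At.
  have [|z Az /andP[tz zU]] := root_between tU; first by rewrite nmulr_rlt0.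
  by exists z => //; rewrite zU ltW.
have convex a m b : A.[a] <= 0 -> A.[b] <= 0 -> a <= m <= b -> A.[m] <= 0.
  move=> Aa Ab /andP[]; rewrite le_eqVlt => /predU1P[<-//|am].
  rewrite le_eqVlt => /predU1P[->//|mb]; rewrite leNgt; apply/negP => Am.
  have [L [AL hL [zL AzL /andP[LzL zLa]]]] := below a (m :: xs) Aa.
  have [U [AU hU [zU AzU /andP[bzU zUU]]]] := above b (m :: xs) Ab.
  have Lm : L < m by rewrite hL // !inE eqxx orbT.
  have mU : m < U by rewrite hU // !inE eqxx orbT.
  have Lx x : x \in xs -> L < x by move=> xxs; rewrite hL // !inE xxs !orbT.
  have xU x : x \in xs -> x < U by move=> xxs; rewrite hU // !inE xxs !orbT.
  have pos_xs x : 0 < A.[x] -> x \notin xs.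
    by move=> Ax; apply: contraL Ax => /hxs[_]; rewrite -leNgt => /ltW.
  (* If A(m) > 0 in a gap, the n zeros of p with L, m and U are n + 3 points, any two separated by a
     root of A. This demands n + 2 roots, one more than there are. *)
  have := @size_le_separators _ _ [:: L, U, m & xs] V _ uV.
  have -> : uniq [:: L, U, m & xs].
    rewrite /= !inE !negb_or uxs !pos_xs // (lt_eqF (lt_trans Lm mU)).
    by rewrite (lt_eqF Lm) (gt_eqF mU).
  rewrite /= sxs => /(_ isT) h.
  suff /leq_trans /(_ (sV : (size V).+1 <= n.+2)%N) : (n.+3 <= (size V).+1)%N by rewrite ltnn.
  apply: h => u v; rewrite !inE.
  have fromV u1 v1 : (exists2 z, root A z & u1 < z < v1) ->
     exists2 z, z \in V & u1 < z < v1 by move=> [z]; rewrite -hV; exists z.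
  move=> hu hv uv; apply: fromV; move: hu hv uv.
  move=> /or4P[/eqP->|/eqP->|/eqP->|uxs'] /or4P[/eqP->|/eqP->|/eqP->|vxs'] uv.
  - by rewrite ltxx in uv.
  - by exists zL => //; rewrite LzL (le_lt_trans zLa) // (lt_trans am).
  - by exists zL => //; rewrite LzL (le_lt_trans zLa).
  - by apply: root_between => //; rewrite pmulr_rlt0 //; case: (hxs _ vxs').
  - by have := lt_trans uv (lt_trans Lm mU); rewrite ltxx.
  - by rewrite ltxx in uv.
  - by have := lt_trans uv mU; rewrite ltxx.
  - by have := lt_trans uv (xU _ vxs'); rewrite ltxx.
  - by have := lt_trans uv Lm; rewrite ltxx.
  - by exists zU => //; rewrite zUU andbT (lt_le_trans mb).
  - by rewrite ltxx in uv.
  - by apply: root_between => //; rewrite pmulr_rlt0 //; case: (hxs _ vxs').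
  - by have := lt_trans uv (Lx _ uxs'); rewrite ltxx.
  - by apply: root_between => //; rewrite nmulr_rlt0 //; case: (hxs _ uxs').
  - by apply: root_between => //; rewrite nmulr_rlt0 //; case: (hxs _ uxs').
  - by apply: root_between_zeros; case: (hxs _ uxs'); case: (hxs _ vxs').
have [x xxs] : exists x, x \in xs.
  by case: (xs) sxs n_gt0 => [<-//|x s _ _]; exists x; rewrite inE eqxx.
have [px Ax] := hxs _ xxs.
have Vx : forall z, root A z -> z != x.
  by move=> z Az; apply: contraTneq Az => ->; rewrite rootE lt_eqF.
have [L [AL _ [zL AzL /andP[_ zLx]]]] := below x [::] (ltW Ax).
have [U [AU _ [zU AzU /andP[xzU _]]]] := above x [::] (ltW Ax).
have [t0 t0V ht0] := @exists_seq_min _ _ V zL (eqbRL (hV zL) AzL).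
have [t1 t1V ht1] := @exists_seq_min _ _ (map -%R V) _ (map_f -%R (eqbRL (hV zU) AzU)).
have {t1 t1V ht1} [t1 t1V ht1] : exists2 t1, t1 \in V & forall y, y \in V -> y <= t1.
  move: t1V => /mapP[t t1V' e]; exists t => // y yV.
  by rewrite -lerN2 -e ht1 // map_f.
(* The inequality is strict because a zero x of p lies between the extreme roots of A, and A(x) < 0
   keeps it off both. *)
exists t0, t1; split.
  have h0 : t0 <= zL by rewrite ht0 // hV.
  have h1 : zU <= t1 by rewrite ht1 // hV.
  have := Vx _ AzL; move: zLx; rewrite le_eqVlt => /orP[->//|zLx _].
  by apply: le_lt_trans h0 (lt_le_trans (lt_le_trans zLx xzU) h1).
have A0 z : z \in V -> A.[z] <= 0 by rewrite hV => /eqP ->.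
move=> t; rewrite AE; apply/idP/idP => [At|]; last by apply: convex; exact: A0.
have [_ [_ _ [z1 Az1 /andP[_ z1t]]]] := below t [::] At.
have [_ [_ _ [z2 Az2 /andP[tz2 _]]]] := above t [::] At.
by rewrite (le_trans (ht0 z1 _)) ?hV //= (le_trans tz2) ?ht1 ?hV.
Qed.

End Interval.

(** * Rational functions in a Moebius coordinate *)

Lemma coefM_top (F : nzRingType) (p q : {poly F}) m k :
  (size p <= m.+1)%N -> (size q <= k.+1)%N -> (p * q)`_(m + k) = p`_m * q`_k.
Proof.
move=> sp sq; rewrite coefM.
have lt_m : (m < (m + k).+1)%N by rewrite ltnS leq_addr.
rewrite (bigD1 (Ordinal lt_m)) //= addKn big1 ?addr0 // => -[j lt_j] /=.
rewrite -val_eqE /= neq_ltn => /orP[jm|mj].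
  by rewrite [q`__]nth_default ?mulr0 // (leq_trans sq) //; lia.
by rewrite nth_default ?mul0r // (leq_trans sp).
Qed.

(** The operator r -> X r' multiplies the coefficient of X^k by k, so the top coefficient of X W is
    (m - (m+1)) p_m q_(m+1), which is nonzero. *)
Lemma size_wronsk_top (F : numFieldType) (p q : {poly F}) m :
  size p = m.+1 -> size q = m.+2 -> size (wronsk p q) = (m.+1.*2).-1.
Proof.
move=> sp sq.
have coefXd (r : {poly F}) k : ('X * r^`())`_k = r`_k *+ k.
  by rewrite coefXM coef_deriv; case: k => //=; rewrite mulr0n.
have sXd (r : {poly F}) : (size ('X * r^`())%R <= size r)%N.
  by apply/leq_sizeP => j hj; rewrite coefXd nth_default // mul0rn.
have e : 'X * wronsk p q = ('X * p^`()) * q - p * ('X * q^`()).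
  by rewrite /wronsk; ring.
have s1 : (size ('X * p^`())%R <= m.+1)%N by rewrite -sp sXd.
have s2 : (size ('X * q^`())%R <= m.+2)%N by rewrite -sq sXd.
have lp : p`_m != 0 by rewrite -[m]/(m.+1.-1) -sp -lead_coefE lead_coef_eq0 -size_poly_eq0 sp.
have lq : q`_m.+1 != 0 by rewrite -[m.+1]/(m.+2.-1) -sq -lead_coefE lead_coef_eq0 -size_poly_eq0 sq.
have top : ('X * wronsk p q)`_(m + m.+1) != 0.
  rewrite e coefB !coefM_top ?sp ?sq // !coefXd.
  by rewrite mulrnAr -mulrnAl -mulrBl mulf_neq0 // mulrS opprD addrCA subrr addr0 oppr_eq0.
have le : (size ('X * wronsk p q)%R <= (m + m.+1).+1)%N.
  rewrite e (leq_trans (size_polyD _ _)) // geq_max size_polyN.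
  apply/andP; split; rewrite (leq_trans (size_polyMleq _ _)) //.
    by rewrite sq; move: (size _) s1 => x; lia.
  by rewrite sp; move: (size _) s2 => x; lia.
have W0 : wronsk p q != 0 by apply: contraNneq top => ->; rewrite mulr0 coef0.
have : size ('X * wronsk p q) = (m + m.+1).+1.
  apply/eqP; rewrite eqn_leq le ltnNge; apply/negP => /leq_sizeP h.
  by rewrite h ?eqxx in top.
rewrite size_mul ?polyX_eq0 // size_polyX /= -muln2.
by move: (size _) => x; lia.
Qed.

Section RationalFunction.
Variable R : realType.
Local Notation C := R[i].
Variable be : ratfun R.
Hypotheses (be_wf : rf_wf be) (be_deg : (0 < rf_deg be)%N).
Local Notation n := (rf_deg be).
Local Notation p := (rf_num be).
Local Notation q := (rf_den be).

Lemma size_num_le : (size p <= n.+1)%N.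
Proof. by rewrite (leq_trans (leqSpred _)) // ltnS leq_maxl. Qed.

Lemma size_den_le : (size q <= n.+1)%N.
Proof. by rewrite (leq_trans (leqSpred _)) // ltnS leq_maxr. Qed.

Lemma size_fiber_le (w : C) : (size (p - w *: q)%R <= n.+1)%N.
Proof.
rewrite (leq_trans (size_polyD _ _)) // geq_max size_num_le size_polyN.
by rewrite (leq_trans (size_scale_leq _ _)) // size_den_le.
Qed.

Lemma num_den_noroot x : root p x -> ~~ root q x.
Proof. by case: be_wf => /coprimep_noroot h _; exact: h. Qed.

(** Coprimality at infinity: one of p, q attains the degree n, so as forms of degree n they have no
    common zero there. *)
Lemma num_den_top : p`_n = 0 -> q`_n != 0.
Proof.
have nz (r : {poly C}) : (size r).-1 = n -> r`_n != 0.
  move=> e; rewrite -e -lead_coefE lead_coef_eq0; apply: contraTneq be_deg => r0.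
  by rewrite -e r0 size_poly0.
move=> /eqP p0; apply/nz/eqP; move: p0; apply: contraTT => qn.
have : (size p).-1 = n; last exact: nz.
move: qn; rewrite /rf_deg /maxn; case: ifP => //.
by rewrite eqxx.
Qed.

(** Replaces the case analysis of [rf_eval] by one condition on the form p - w q of degree n,
    uniform over the sphere. *)
Lemma rf_evalP z (w : C) : rf_eval be z = Some w <->
  match z with Some x => root (p - w *: q) x | None => (p - w *: q)`_n == 0 end.
Proof.
case: z => [x|] /=; rewrite ?rootE ?coefB ?coefZ ?hornerD ?hornerN ?hornerZ.
  rewrite subr_eq0; case: eqVneq => /= [qx|qx].
    split=> // /eqP px; have := num_den_noroot; move=> /(_ x).
    by rewrite !rootE px qx mulr0 eqxx => /(_ isT).
  split=> [[<-]|/eqP ->]; first by rewrite divfK.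
  by rewrite mulfK.
have top := num_den_top.
have sp := size_num_le; have sq := size_den_le.
have lc (r : {poly C}) : size r = n.+1 -> lead_coef r = r`_n by rewrite lead_coefE => ->.
have nn : n = (size p).-1 \/ n = (size q).-1.
  by rewrite /rf_deg /maxn; case: ifP; [right|left].
have [_ q0] := be_wf; rewrite -size_poly_gt0 in q0.
have [lt_pq|le_qp] := ltnP (size p) (size q).
  have en : size q = n.+1.
    case: nn => h; move: be_deg lt_pq q0 sp sq; rewrite h; move: (size p) (size q) => k l; lia.
  have pn : p`_n = 0 by rewrite nth_default // -ltnS -en.
  have qn := top pn; rewrite pn sub0r oppr_eq0 mulf_eq0 (negPf qn) orbF.
  by split=> [[<-]|/eqP ->].
have en : size p = n.+1.
  case: nn => h; move: be_deg le_qp q0 sp sq; rewrite h; move: (size p) (size q) => k l; lia.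
have [epq|npq] := eqVneq (size p) (size q).
  have qn : q`_n != 0 by rewrite -lc -?epq // lead_coef_eq0 -size_poly_gt0.
  rewrite !lc -?epq // subr_eq0; split=> [[<-]|/eqP ->]; first by rewrite divfK.
  by rewrite mulfK.
have qn : q`_n = 0.
  by rewrite nth_default //; move: npq le_qp; rewrite en; move: (size q) (rf_deg be) => k l; lia.
rewrite qn mulr0 subr0 -lc // lead_coef_eq0 -size_poly_eq0 en.
by split.
Qed.

(** If p = w q, coprimality leaves q without roots, so p and q are constant, against the positive
    degree. *)
Lemma fiber_neq0 (w : C) : p - w *: q != 0.
Proof.
apply/eqP => h; have [[|m] e] : exists m, n = m by exists n.
  by move: be_deg; rewrite e.
have hp : p = w *: q by apply/eqP; rewrite -subr_eq0 h.
have hx x : ~~ root q x.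
  apply/negP => qx; move: (qx); apply/negP/num_den_noroot.
  by rewrite hp rootE hornerZ (rootP qx) mulr0.
have sq1 : size q = 1.
  by apply/eqP; apply: contraT => /closed_rootP[x qx]; rewrite (negPf (hx x)) in qx.
move: be_deg; rewrite /rf_deg sq1 maxn0 hp; apply/negP; rewrite -leqNgt.
by rewrite -subn1 leq_subLR addn0 -[1%N]sq1 size_scale_leq.
Qed.

End RationalFunction.

(** * Transport of a rational function to a Moebius coordinate *)

Section Moebius.
Variables (R : realType) (a b c d : R[i]).
Local Notation C := R[i].
Hypotheses (c0 : c != 0) (det0 : a * d - b * c != 0).
Local Notation N := (a *: 'X + b%:P).
Local Notation D := (c *: 'X + d%:P).
Let zs := a / c.

(** The argument is a finite t: infinity would go to [zs] = a / c, the only point of the sphere that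
    is missed. *)
Definition mobius (t : C) : CP1 R :=
  if D.[t] != 0 then Some (N.[t] / D.[t]) else None.

Lemma horner_mobN t : N.[t] = a * t + b. Proof. by rewrite !hornerE. Qed.
Lemma horner_mobD t : D.[t] = c * t + d. Proof. by rewrite !hornerE. Qed.

Lemma mobius_det t : a * D.[t] - c * N.[t] = a * d - b * c.
Proof. rewrite horner_mobN horner_mobD; ring. Qed.

Lemma mobius_N_neq0 t : D.[t] = 0 -> N.[t] != 0.
Proof.
move=> Dt; apply: contraNneq det0 => Nt.
by rewrite -(mobius_det t) Dt Nt !mulr0 subrr.
Qed.

Lemma root_hcomp n (r : {poly C}) t : (size r <= n.+1)%N ->
  root (hcomp n r N D) t =
  match mobius t with Some x => root r x | None => r`_n == 0 end.
Proof.
move=> sr; rewrite /mobius; case: eqVneq => /= [Dt|Dt].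
  by rewrite rootE horner_hcomp0 // mulf_eq0 expf_eq0 (negPf (mobius_N_neq0 Dt)) andbF orbF.
by rewrite !rootE horner_hcomp // mulf_eq0 expf_eq0 (negPf Dt) andbF.
Qed.

(** The top coefficient is the behaviour at infinity of the coordinate, that is, the value of r at
    [zs], up to a power of c. *)
Lemma hcomp_top n (r : {poly C}) : (size r <= n.+1)%N ->
  (size (hcomp n r N D) <= n.+1)%N /\ (hcomp n r N D)`_n = c ^+ n * r.[zs].
Proof.
have linpow (k l : C) i : (size ((k *: 'X + l%:P) ^+ i)%R <= i.+1)%N /\
    ((k *: 'X + l%:P) ^+ i)`_i = k ^+ i.
  have sl : (size (k *: 'X + l%:P)%R <= 2)%N.
    rewrite (leq_trans (size_polyD _ _)) // geq_max (leq_trans (size_scale_leq _ _)) ?size_polyX //.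
    by rewrite (leq_trans (size_polyC_leq1 _)).
  elim: i => [|i [IH1 IH2]]; first by rewrite !expr0 size_poly1 coefC.
  rewrite !exprS; split.
    rewrite (leq_trans (size_polyMleq _ _)) //.
    move: (size _) (size _) sl IH1 => x y; lia.
  rewrite -[i.+1]/(1 + i)%N coefM_top // IH2.
  by rewrite coefD coefZ coefX coefC mulr1 addr0.
move=> sr.
have st i : (i <= n)%N -> (size (N ^+ i * D ^+ (n - i))%R <= n.+1)%N /\
    (N ^+ i * D ^+ (n - i))`_n = a ^+ i * c ^+ (n - i).
  move=> le_in; have [s1 e1] := linpow a b i; have [s2 e2] := linpow c d (n - i)%N.
  split; last by rewrite -{2}(subnKC le_in) coefM_top // e1 e2.
  rewrite (leq_trans (size_polyMleq _ _)) //.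
  move: (size _) (size _) s1 s2 => x y; lia.
split.
  rewrite /hcomp (leq_trans (size_sum _ _ _)) //; apply/bigmax_leqP => i _.
  by rewrite (leq_trans (size_scale_leq _ _)) //; case: (st i) => //; rewrite -ltnS.
rewrite /hcomp coef_sum (horner_coef_wide _ sr) mulr_sumr; apply: eq_bigr => i _.
have le_in : (i <= n)%N by rewrite -ltnS.
rewrite coefZ; have [_ ->] := st i le_in.
have -> : c ^+ n = c ^+ (n - i) * c ^+ i by rewrite -exprD subnK.
rewrite /zs expr_div_n.
have := expf_neq0 i c0; move: (c ^+ i) (c ^+ (n - i)) => u v u0.
by field.
Qed.


Section Belyi.
Variable be : ratfun R.
Hypotheses (be_wf : rf_wf be) (be_deg : (0 < rf_deg be)%N).
Local Notation n := (rf_deg be).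
Local Notation p := (rf_num be).
Local Notation q := (rf_den be).
Local Notation p' := (hcomp n p N D).
Local Notation q' := (hcomp n q N D).

Lemma rf_eval_mobius t (w : C) :
  rf_eval be (mobius t) = Some w <-> root (p' - w *: q') t.
Proof.
by rewrite (rf_evalP be_wf be_deg) -hcompB root_hcomp ?size_fiber_le //; case: mobius.
Qed.

Lemma coprimep_hcomp : coprimep p' q'.
Proof.
apply/coprimep_noroot => t; rewrite !root_hcomp ?size_num_le ?size_den_le //.
case: mobius => [x|]; first exact: (num_den_noroot be_wf).
by move=> /eqP/(num_den_top be_deg).
Qed.

(** With w the value at t, a zero of the Wronskian off the poles is a double root of p' - w q';
    undoing the substitution gives local degree at least 2 at the image point. *)
Lemma wronsk_hcomp_critical t :
  root (wronsk p' q') t -> ~~ root q' t -> critical_point be (mobius t).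
Proof.
move=> Wt qt; pose w := p'.[t] / q'.[t].
have qt' : q'.[t] != 0 by rewrite -rootE.
have rt : root (p' - w *: q') t by rewrite rootE !hornerE divfK // subrr.
have ew : rf_eval be (mobius t) = Some w by apply/rf_eval_mobius.
have dt : root (p' - w *: q')^`() t.
  move: Wt; rewrite -(wronskBl w) rootE /wronsk hornerD hornerN !hornerM.
  by rewrite (rootP rt) mul0r subr0 mulf_eq0 (negPf qt') orbF.
rewrite /critical_point ew /locdeg; set r := p - w *: q.
have r0 : r != 0 := fiber_neq0 be_wf be_deg w.
have sr := size_fiber_le be w; rewrite -/r in sr.
have [m en] : exists m, n = m.+1 by exists n.-1; rewrite prednK.
rewrite -hcompB -/r en in rt dt; rewrite en in sr.
have := root_hcomp t sr; rewrite rt /mobius.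
case: eqVneq => /= Dt.
  (* The image is infinity: the zero of the form and that of its derivative kill the two top
     coefficients of r. *)
  move=> /esym/eqP rn.
  have sr' : (size r <= m.+1)%N.
    apply/leq_sizeP => j; rewrite leq_eqVlt => /predU1P[<- //|hj].
    by rewrite nth_default // (leq_trans sr).
  move: dt; rewrite hcompS // derivM rootE hornerD !hornerM Dt mul0r addr0.
  rewrite derivD derivZ derivX derivC addr0 hornerZ hornerC mulr1 mulf_eq0 (negPf c0) /=.
  rewrite horner_hcomp0 // mulf_eq0 expf_eq0 (negPf (mobius_N_neq0 Dt)) andbF orbF => /eqP rm.
  have sr'' : (size r <= m)%N.
    apply/leq_sizeP => j; rewrite leq_eqVlt => /predU1P[<- //|hj].
    by rewrite nth_default // (leq_trans sr').
  rewrite /rf_deg -/n en; move: r0; rewrite -size_poly_gt0; move: (size r) sr'' => k; lia.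
set x := N.[t] / D.[t] => /esym rx0; have {rx0} rx : root r x by rewrite rx0.
have /factor_theorem[s es] := rx.
have sE : r = ('X - x%:P) * s by rewrite mulrC.
have ss : (size s <= m.+1)%N.
  move: sr; rewrite es size_Mmonic ?monicXsubC ?size_XsubC //.
    by move: (size s) => k; lia.
  by apply: contraNneq r0 => s0; rewrite es s0 mul0r.
(* N - x D has a simple zero at t, its derivative there being nonzero by the determinant; the second
   zero must come from the cofactor s. *)
have Lt : (N - x *: D).[t] = 0.
  by rewrite hornerD hornerN hornerZ /x divfK // subrr.
have L't : (N - x *: D)^`().[t] != 0.
  rewrite derivB derivZ !derivD !derivZ derivX !derivC !addr0.
  rewrite hornerD hornerN !hornerZ hornerC !mulr1.
  apply: contraNneq det0 => h; rewrite -(mobius_det t).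
  have -> : N.[t] = x * D.[t] by rewrite /x divfK.
  by rewrite mulrA -mulrBl [c * x]mulrC h mul0r.
move: dt; rewrite sE hcomp_XsubC // derivM rootE hornerD !hornerM Lt mul0r addr0.
rewrite mulf_eq0 (negPf L't) /= -rootE root_hcomp // /mobius Dt => sx.
by rewrite mup_geq ?hcomp_XsubC -?sE // sE expr2 dvdp_mul2l ?polyXsubC_eq0 // dvdp_XsubCl.
Qed.

(** Let w be the value at [zs]. As [zs] is not critical, p - w q vanishes there to order exactly
    one, so its transform has degree n - 1 while that of q has degree n; the Wronskian does not see
    the subtraction of w q. *)
Lemma size_wronsk_hcomp : ~~ root q zs -> ~ critical_point be (Some zs) ->
  size (wronsk p' q') = (n.*2).-1.
Proof.
move=> qz; rewrite /critical_point /= -rootE qz => /negP crit.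
pose w := p.[zs] / q.[zs]; rewrite -/w in crit.
set r := p - w *: q in crit.
have r0 : r != 0 := fiber_neq0 be_wf be_deg w.
have rz : root r zs by rewrite rootE !hornerE /w divfK // subrr.
have sr := size_fiber_le be w; rewrite -/r in sr.
have [m en] : exists m, n = m.+1 by exists n.-1; rewrite prednK.
have /factor_theorem[s es] := rz.
have sE : r = ('X - zs%:P) * s by rewrite mulrC.
have s0 : s != 0 by apply: contraNneq r0 => s0; rewrite es s0 mul0r.
have ss : (size s <= m.+1)%N.
  move: sr; rewrite es size_Mmonic ?monicXsubC ?size_XsubC // en.
  by move: (size s) => k; lia.
have sz : s.[zs] != 0.
  apply: contra crit; rewrite -rootE => sz.
  by rewrite mup_geq // sE expr2 dvdp_mul2l ?polyXsubC_eq0 // dvdp_XsubCl.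
have -> : wronsk p' q' = wronsk (hcomp n r N D) q' by rewrite hcompB wronskBl.
(* Since [zs] = a / c, the factor N - zs D loses its linear term and is constant. *)
have e1 : hcomp n r N D = (b - zs * d) *: hcomp m s N D.
  rewrite en sE hcomp_XsubC // -[RHS]mul_polyC; congr (_ * _).
  rewrite scalerDr scalerA /zs divfK // -[_ *: d%:P]mul_polyC polyCB !polyCM.
  by rewrite opprD addrACA subrr add0r.
have k0 : b - zs * d != 0.
  apply: contraNneq det0 => h; have -> : b = zs * d by apply/eqP; rewrite -subr_eq0 h.
  by rewrite /zs; apply/eqP; field.
have [t1 t2] := hcomp_top ss; have [t3 t4] := hcomp_top (size_den_le be).
have exact_size k (u : {poly C}) : (size u <= k.+1)%N -> u`_k != 0 -> size u = k.+1.
  move=> su uk; apply/eqP; rewrite eqn_leq su ltnNge; apply/negP => /leq_sizeP h.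
  by rewrite h ?eqxx in uk.
have -> : (n.*2).-1 = (m.+1.*2).-1 by rewrite en.
apply: size_wronsk_top.
  rewrite e1 size_scale //; apply: exact_size => //.
  by rewrite t2 mulf_neq0 // expf_neq0.
by rewrite -en; apply: exact_size => //; rewrite t4 mulf_neq0 // expf_neq0.
Qed.

End Belyi.
End Moebius.

(** * The Schwarz function of the support *)

Section Generic.
Variable R : realType.
Local Notation C := R[i].
Local Notation toC := (real_complex R).

(** Zariski density in C, equivalent to being infinite, in a form that absorbs exceptional
    polynomials. *)
Definition zdense (S : set C) :=
  forall T : {poly C}, T != 0 -> exists2 z, S z & ~~ root T z.

Lemma zdense_eq (S : set C) (p q : {poly C}) : zdense S ->
  (forall z, S z -> p.[z] = q.[z]) -> p = q.
Proof.
move=> dS h; apply/eqP; rewrite -subr_eq0; apply/negPn/negP => /dS[z /h e].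
by rewrite rootE !hornerE e subrr eqxx.
Qed.

Lemma exists_real_nonroot (S : {poly C}) (l u : R) : S != 0 -> l < u ->
  exists2 c, l < c < u & ~~ root S (toC c).
Proof.
(* The interval receives size S sample points, one more than the degree of S. *)
move=> S0 lu; pose k := size S.
pose f (i : nat) := l + (u - l) * (i.+1%:R / k.+1%:R).
have k0 : 0 < k.+1%:R :> R by rewrite ltr0n.
have inj_f : injective f.
  move=> i j /addrI/mulfI; rewrite gt_eqF ?subr_gt0 // => /(_ isT).
  move/mulIf; rewrite invr_eq0 gt_eqF // => /(_ isT)/eqP.
  by rewrite eqr_nat eqSS => /eqP.
pose rs := map (toC \o f) (iota 0 k).
have urs : uniq rs.
  rewrite map_inj_uniq ?iota_uniq //; apply: inj_comp => //; exact: complexI.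
have [ars|] := boolP (all (root S) rs).
  by have := max_poly_roots S0 ars urs; rewrite size_map size_iota ltnn.
rewrite /rs all_map => /allPn[] i; rewrite mem_iota add0n /= => ik nr.
exists (f i) => //; rewrite /f.
have q0 : 0 < i.+1%:R / k.+1%:R :> R by rewrite divr_gt0.
have q1 : i.+1%:R / k.+1%:R < 1 :> R by rewrite ltr_pdivrMr // mul1r ltr_nat.
move: (i.+1%:R / k.+1%:R) q0 q1 => s s0 s1.
have := mulr_gt0 (_ : 0 < u - l) s0; rewrite subr_gt0 => /(_ lu).
have : 0 < 1 - s by rewrite subr_gt0.
have : 0 < u - l by rewrite subr_gt0.
by move=> h1 h2; have := mulr_gt0 h1 h2; lra.
Qed.

(** The bad c are roots of one polynomial: the factor p(t) - c q(t) for each root t of T, and p_n -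
    c q_n for infinity. No factor is zero, as p and q have no common zero, even at infinity. *)
Lemma generic_fiber (p q T : {poly C}) n (l u : R) :
  (forall x, root p x -> ~~ root q x) -> (p`_n = 0 -> q`_n != 0) ->
  T != 0 -> l < u ->
  exists c, [/\ l < c < u, (p - toC c *: q)`_n != 0 &
    forall z, root (p - toC c *: q) z -> ~~ root T z].
Proof.
move=> cpq top T0 lu; have [rs eT] := closed_field_poly_normal T.
pose S := \prod_(ab <- (p`_n, q`_n) :: [seq (p.[t], q.[t]) | t <- rs])
  (ab.1%:P - ab.2 *: 'X).
have S0 : S != 0.
  rewrite prodf_seq_neq0; apply/allP => -[x y] xy /=.
  apply/eqP => /(congr1 (fun r : {poly C} => (r`_0, r`_1))).
  rewrite !coefB !coefC !coefZ !coefX /= !mulr0 mulr1 subr0 sub0r ?coef0.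
  move=> [x0 /eqP]; rewrite oppr_eq0 => y0; move: xy; rewrite x0 inE xpair_eqE.
  rewrite (eqP y0) => /orP[/andP[/eqP pn /eqP qn]|/mapP[t _ [pt qt]]].
    by have := top (esym pn); rewrite -qn eqxx.
  by have := cpq t; rewrite !rootE -pt -qt eqxx => /(_ isT).
have [c lcu Sc] := exists_real_nonroot S0 lu; exists c; split=> //.
  apply: contra Sc; rewrite coefB coefZ /S big_cons rootM => /eqP e.
  by apply/orP; left; rewrite rootE !hornerE [_ * toC c]mulrC e.
move=> z pz; apply: contra Sc => Tz; rewrite /S big_cons rootM; apply/orP; right.
have zrs : z \in rs.
  by move: Tz; rewrite eT rootZ ?lead_coef_eq0 // root_prod_XsubC.
rewrite big_map (perm_big _ (perm_to_rem zrs)) big_cons rootM; apply/orP; left.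
by move: pz; rewrite !rootE !hornerE [_ * toC c]mulrC.
Qed.

End Generic.

(** * From identities between fractions to identities between values *)

Section Representation.
Variable R : realType.
Local Notation C := R[i].
Variable E : {poly C}.

(** A fraction has no value at a point by itself; a representative whose denominator is nonzero
    wherever E is ties it to a function. *)
Definition takes_values (u : {fraction {poly C}}) (phi : C -> C) :=
  exists N D : {poly C}, [/\ D != 0, u = N%:F / D%:F &
    forall z, E.[z] != 0 -> D.[z] != 0 /\ phi z = N.[z] / D.[z]].

Lemma takes_valuesC (c : C) : takes_values (c%:P)%:F (fun=> c).
Proof.
exists c%:P, 1; split; rewrite ?oner_eq0 ?tofrac1 ?divr1 // => z _.
by rewrite !hornerE divr1 oner_eq0.
Qed.

Lemma takes_valuesD u v f g : takes_values u f -> takes_values v g ->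
  takes_values (u + v) (fun z => f z + g z).
Proof.
move=> [N1 [D1 [n1 -> h1]]] [N2 [D2 [n2 -> h2]]].
exists (N1 * D2 + N2 * D1), (D1 * D2); split; first by rewrite mulf_neq0.
  by rewrite tofracD !tofracM addf_div // tofrac_eq0.
move=> z Ez; have [d1 ->] := h1 z Ez; have [d2 ->] := h2 z Ez.
by rewrite !hornerE mulf_neq0 // addf_div.
Qed.

Lemma takes_valuesM u v f g : takes_values u f -> takes_values v g ->
  takes_values (u * v) (fun z => f z * g z).
Proof.
move=> [N1 [D1 [n1 -> h1]]] [N2 [D2 [n2 -> h2]]].
exists (N1 * N2), (D1 * D2); split; first by rewrite mulf_neq0.
  by rewrite !tofracM mulf_div.
move=> z Ez; have [d1 ->] := h1 z Ez; have [d2 ->] := h2 z Ez.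
by rewrite !hornerM mulf_neq0 // mulf_div.
Qed.

Lemma takes_valuesX u f n : takes_values u f ->
  takes_values (u ^+ n) (fun z => f z ^+ n).
Proof.
move=> h; elim: n => [|n IH].
  by rewrite expr0 -tofrac1; exact: (takes_valuesC 1).
have := takes_valuesM h IH; rewrite -exprS.
by under [X in takes_values _ X]funext => z do rewrite -exprS.
Qed.

Lemma takes_values_sum n (u : 'I_n -> {fraction {poly C}}) (f : 'I_n -> C -> C) :
  (forall i, takes_values (u i) (f i)) ->
  takes_values (\sum_(i < n) u i) (fun z => \sum_(i < n) f i z).
Proof.
elim: n u f => [|n IH] u f h.
  rewrite big_ord0 (_ : (fun z => _) = fun=> 0); last first.
    by apply/funext => z; rewrite big_ord0.
  by rewrite -tofrac0 -polyC0; exact: takes_valuesC.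
rewrite big_ord_recl (_ : (fun z => _) =
    (fun z => f ord0 z + \sum_(i < n) f (lift ord0 i) z)); last first.
  by apply/funext => z; rewrite big_ord_recl.
by apply: takes_valuesD => //; apply: IH.
Qed.

End Representation.

Section Schwarz.
Variable R : realType.
Local Notation C := R[i].
Local Notation toC := (real_complex R).

Lemma takes_values_poly E (U V : {fraction {poly C}}) (u v : C -> C)
    m (k : nat -> nat) (f : nat -> nat -> C) :
  takes_values E U u -> takes_values E V v ->
  takes_values E (\sum_(i < m) (\sum_(j < k i) ((f i j)%:P)%:F * V ^+ j) * U ^+ i)
    (fun z => \sum_(i < m) (\sum_(j < k i) f i j * v z ^+ j) * u z ^+ i).
Proof.
move=> hU hV; apply: takes_values_sum => i; apply: takes_valuesM.
  apply: takes_values_sum => j; apply: takes_valuesM; first exact: takes_valuesC.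
  exact: takes_valuesX.
exact: takes_valuesX.
Qed.

Lemma takes_values_rf (b : ratfun R) E : rf_wf b -> rf_den b %| E ->
  takes_values E (rf_frac b) (fun z => (rf_num b).[z] / (rf_den b).[z]).
Proof.
move=> [_ q0] /dvdpP[s ->]; exists (rf_num b), (rf_den b); split=> // z.
by rewrite hornerM mulf_eq0 negb_or => /andP[_ ->].
Qed.

Lemma rf_eval_Some (b : ratfun R) z (w : C) : rf_eval b (Some z) = Some w ->
  (rf_den b).[z] != 0 /\ (rf_num b).[z] / (rf_den b).[z] = w.
Proof. by rewrite /=; case: ifP => // qz [<-]. Qed.

Lemma cross_ratio (F : fieldType) (a b c d : F) : b != 0 -> c != 0 -> d != 0 ->
  a / b / (c / d) * c * b = a * d.
Proof. by move=> b0 c0 d0; field; rewrite b0 c0 d0. Qed.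

Lemma mul_cross (F : fieldType) (a b c d x : F) : b != 0 -> d != 0 ->
  x * c * b = a * d -> a / b = x * (c / d).
Proof. by move=> b0 d0 e; rewrite mulrA; apply/eqP; rewrite eqr_div // e. Qed.

Lemma mul_cross_inv (F : fieldType) (a b c d x : F) : b != 0 -> d != 0 ->
  a / b = x * (c / d) -> a * d = x * c * b.
Proof.
by move=> b0 d0 /eqP; rewrite mulrA eqr_div // => /eqP.
Qed.

(** At a point with real values x, y one has z = P(x,y)/Q(x,y), so conj z is the quotient of the
    polynomials with conjugate coefficients at the same x, y. Substituting b1, b2 for x, y gives
    N/D. *)
Lemma schwarz_function (b1 b2 : ratfun R) : rf_wf b1 -> rf_wf b2 ->
  generate_Cz b1 b2 ->
  exists N D G : {poly C}, G != 0 /\ forall z x y, ~~ root G z ->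
    rf_eval b1 (Some z) = Some (toC x) -> rf_eval b2 (Some z) = Some (toC y) ->
    D.[z] != 0 /\ conjc z * D.[z] = N.[z].
Proof.
move=> wf1 wf2 [P [Q [Q0 eX]]]; pose E := rf_den b1 * rf_den b2.
have E0 : E != 0 by case: wf1 => _ ?; case: wf2 => _ ?; rewrite mulf_neq0.
have t1 := takes_values_rf wf1 (dvdp_mulr (rf_den b2) (dvdpp _)).
have t2 := takes_values_rf wf2 (dvdp_mull (rf_den b1) (dvdpp _)).
rewrite -/E in t1 t2.
pose val (S : {poly {poly C}}) (g : C -> C) (u v : C) :=
  \sum_(i < size S) (\sum_(j < size S`_i) g S`_i`_j * v ^+ j) * u ^+ i.
have tv (S : {poly {poly C}}) (g : C -> C) := takes_values_poly (size S)
  (fun i => size S`_i) (fun i j => g S`_i`_j) t1 t2.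
have [NP [DP [dP eP vP]]] := tv P id.
have [NQ [DQ [dQ eQ vQ]]] := tv Q id.
have [MP [BP [bP _ wP]]] := tv P conjc.
have [MQ [BQ [bQ _ wQ]]] := tv Q conjc.
have valM (g : {rmorphism C -> C}) S (x y : R) : (forall r, g (toC r) = toC r) ->
    val S g (toC x) (toC y) = g (val S id (toC x) (toC y)).
  move=> gR; rewrite /val rmorph_sum; apply: eq_bigr => i _.
  rewrite rmorphM rmorph_sum rmorphXn gR; congr (_ * _).
  by apply: eq_bigr => j _; rewrite rmorphM rmorphXn gR.
have valJ S (x y : R) : val S conjc (toC x) (toC y) = conjc (val S id (toC x) (toC y)).
  by apply: (valM (@conjc R)) => r; exact: conjc_real.
have eQ' : eval2 Q (rf_frac b1) (rf_frac b2) = NQ%:F / DQ%:F := eQ.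
have eP' : eval2 P (rf_frac b1) (rf_frac b2) = NP%:F / DP%:F := eP.
have nQ : NQ != 0.
  by apply: contraNneq Q0 => nQ; rewrite eQ' nQ tofrac0 mul0r.
have eqX : 'X * NQ * DP = NP * DQ.
  apply/eqP; rewrite -tofrac_eq !tofracM eX eQ' eP'.
  by rewrite cross_ratio ?tofrac_eq0.
(* The excluded points are the poles of b1 and b2 (zeros of E) and the zeros of [NQ], the numerator
   of Q(b1,b2). *)
exists (MP * BQ), (MQ * BP), (NQ * E); split; first by rewrite mulf_neq0.
move=> z x y; rewrite rootM negb_or !rootE => /andP[NQz Ez].
move=> /rf_eval_Some[q1z e1] /rf_eval_Some[q2z e2].
have [dPz] := vP z Ez; have [dQz] := vQ z Ez.
have [bPz] := wP z Ez; have [bQz] := wQ z Ez.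
rewrite e1 e2 -!/(val _ _ _ _) !valJ => cQ cP vQz vPz.
(* At real x, y the conjugated Q takes the conjugate of the nonzero value of Q. *)
have MQz : MQ.[z] / BQ.[z] != 0.
  rewrite -cQ conjc_eq0; move: vQz; rewrite /val => ->.
  by rewrite mulf_neq0 // invr_eq0.
split; first by rewrite hornerM mulf_neq0 //; apply: contraNneq MQz => ->; rewrite mul0r.
have ez : val P id (toC x) (toC y) = z * val Q id (toC x) (toC y).
  rewrite /val vPz vQz; apply: mul_cross => //.
  by have /(congr1 (horner^~ z)) := eqX; rewrite !hornerM hornerX.
have ec : MP.[z] / BP.[z] = conjc z * (MQ.[z] / BQ.[z]).
  by rewrite -cP -cQ ez; exact: (rmorphM (@conjc R)).
by rewrite !hornerM mulrA; apply/esym/mul_cross_inv.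
Qed.

End Schwarz.

Lemma deriv_eq0_size (F : numFieldType) (p : {poly F}) : p^`() = 0 -> (size p <= 1)%N.
Proof.
move=> dp; apply/leq_sizeP => -[//|j] _.
have /(congr1 (fun r : {poly F} => r`_j)) := dp; rewrite coef_deriv coef0.
by move=> /eqP; rewrite mulrn_eq0 /= => /eqP.
Qed.

(** From p' q = p q' and coprimality q divides q', which has smaller degree; hence q' = 0, and then
    p' = 0. *)
Lemma wronsk_eq0_size (F : numFieldType) (p q : {poly F}) : coprimep p q ->
  q != 0 -> wronsk p q = 0 -> (size p <= 1)%N /\ (size q <= 1)%N.
Proof.
move=> cpq q0 W0; have e : p^`() * q = p * q^`() by apply/eqP; rewrite -subr_eq0 -/(wronsk p q) W0.
have dq : q^`() = 0.
  apply/eqP; apply: contraT => dq0.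
  have : q %| q^`() by rewrite -(@Gauss_dvdpr _ q^`() p) 1?coprimep_sym // -e dvdp_mull.
  by move=> /(dvdp_leq dq0); rewrite leqNgt lt_size_deriv.
split; last exact: deriv_eq0_size.
apply: deriv_eq0_size; apply/eqP; move: e; rewrite dq mulr0 => /eqP.
by rewrite mulf_eq0 (negPf q0) orbF.
Qed.

(** * Generalised circles and functions agreeing with conjugation *)

Section Circle.
Variable R : realType.
Local Notation C := R[i].
Local Notation toC := (real_complex R).
Local Notation Re := (@complex.Re R).
Local Notation Im := (@complex.Im R).

Definition circle_eq (al be ga de : R) (z : C) : Prop :=
  al * (Re z ^+ 2 + Im z ^+ 2) + be * Re z + ga * Im z + de = 0.

(** On the curve the discriminant is the squared norm of the gradient. If it is 0, every point of
    the curve is singular, and a nontrivial equation has at most one such point. *)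
Lemma circle_discr_gt0 al be ga de (z w : C) :
  ~~ [&& al == 0, be == 0, ga == 0 & de == 0] -> z != w ->
  circle_eq al be ga de z -> circle_eq al be ga de w ->
  0 < be ^+ 2 + ga ^+ 2 - 4 * al * de.
Proof.
case: z w => [x y] [x' y'] nz ne; rewrite /circle_eq /= => ez ew.
have sq (s t : R) : al * (s ^+ 2 + t ^+ 2) + be * s + ga * t + de = 0 ->
    be ^+ 2 + ga ^+ 2 - 4 * al * de = (2 * al * s + be) ^+ 2 + (2 * al * t + ga) ^+ 2.
  move=> e; transitivity (be ^+ 2 + ga ^+ 2 - 4 * al * de + 4 * al *
    (al * (s ^+ 2 + t ^+ 2) + be * s + ga * t + de)); last by ring.
  by rewrite e mulr0 addr0.
have D0 : 0 <= be ^+ 2 + ga ^+ 2 - 4 * al * de by rewrite (sq _ _ ez) addr_ge0 ?sqr_ge0.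
rewrite lt_neqAle D0 andbT eq_sym; apply/eqP => D.
have [al0|al0] := eqVneq al 0.
  move: D; rewrite al0 mulr0 mul0r subr0 => /eqP.
  rewrite paddr_eq0 ?sqr_ge0 // !expf_eq0 /= => /andP[/eqP be0 /eqP ga0].
  move: nz ez; rewrite al0 be0 ga0 !eqxx !mul0r !add0r => /eqP. by [].
have z2 (s t : R) : al * (s ^+ 2 + t ^+ 2) + be * s + ga * t + de = 0 ->
    2 * al * s + be = 0 /\ 2 * al * t + ga = 0.
  move=> /sq; rewrite D => /esym/eqP.
  by rewrite paddr_eq0 ?sqr_ge0 // !expf_eq0 /= => /andP[/eqP -> /eqP ->].
have [h1 h2] := z2 _ _ ez; have [h3 h4] := z2 _ _ ew.
move/eqP: ne; apply; congr Complex.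
  by apply: (mulfI (_ : 2 * al != 0)); rewrite ?mulf_neq0 ?pnatr_eq0 //; lra.
by apply: (mulfI (_ : 2 * al != 0)); rewrite ?mulf_neq0 ?pnatr_eq0 //; lra.
Qed.

Lemma map_conjc_horner (p : {poly C}) z : (map_poly conjc p).[conjc z] = conjc p.[z].
Proof. exact: (horner_map (@conjc R)). Qed.

Lemma conjcM (z w : C) : conjc (z * w) = conjc z * conjc w.
Proof. exact: (rmorphM (@conjc R)). Qed.

(** Applying conjugation twice gives, first on S and then as the polynomial identity [eH], that
    conj(N)/conj(D) evaluated at N/D is z. So N(y)/D(y) = conj z with z in S forces y = z. *)
Lemma schwarz_degree1 (S : set C) (N D : {poly C}) : zdense S -> coprimep N D ->
  (forall z, S z -> D.[z] != 0 /\ conjc z * D.[z] = N.[z]) ->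
  (size N <= 2)%N /\ (size D <= 2)%N.
Proof.
move=> dS cND hS; pose k := maxn (size N) (size D).
have D0 : D != 0.
  have [z /hS[Dz _] _] := dS 1 (oner_neq0 _).
  by apply: contraNneq Dz => ->; rewrite horner0.
have sN : (size (map_poly (@conjc R) N) <= k.+1)%N.
  by rewrite size_map_poly ltnW // ltnS leq_maxl.
have sD : (size (map_poly (@conjc R) D) <= k.+1)%N.
  by rewrite size_map_poly ltnW // ltnS leq_maxr.
have quot y (w : C) : D.[y] != 0 -> w * D.[y] = N.[y] -> N.[y] / D.[y] = w.
  by move=> Dy <-; rewrite mulfK.
have conj_eq z : S z -> (map_poly (@conjc R) N).[conjc z] = z * (map_poly (@conjc R) D).[conjc z].
  by move=> /hS[_ e]; rewrite !map_conjc_horner -e conjcM conjcK.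
have eH : hcomp k (map_poly (@conjc R) N) N D = 'X * hcomp k (map_poly (@conjc R) D) N D.
  apply: (zdense_eq dS) => z Sz; have [Dz ez] := hS _ Sz.
  rewrite hornerM hornerX !horner_hcomp // (quot _ _ Dz ez) (conj_eq _ Sz).
  by rewrite mulrCA.
have uniq_root z y : S z -> root (N - conjc z *: D) y -> y = z.
  move=> Sz; have [Dz ez] := hS _ Sz.
  rewrite rootE hornerD hornerN hornerZ subr_eq0 => /eqP ey.
  have Dy : D.[y] != 0.
    apply/eqP => Dy; have := (coprimep_noroot _ _ cND) y.
    by rewrite !rootE ey Dy mulr0 eqxx => /(_ isT).
  have /(congr1 (horner^~ y)) := eH; rewrite hornerM hornerX !horner_hcomp //.
  rewrite (quot _ _ Dy (esym ey)) mulrCA => /(mulfI (expf_neq0 k Dy)).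
  rewrite (conj_eq _ Sz) => /mulIf e; apply/esym/e.
  by rewrite map_conjc_horner conjc_eq0.
(* Otherwise N/D is constant, so conj z is constant on S, which is infinite. *)
have W0 : wronsk N D != 0.
  apply/eqP => /(wronsk_eq0_size cND D0)[/size1_polyC eN /size1_polyC eD].
  have [z /hS[]] := dS ('X - (conjc (N`_0 / D`_0))%:P) (negbT (polyXsubC_eq0 _)).
  rewrite eN eD !hornerC !coefC /= => d0 e.
  by rewrite root_XsubC -e mulfK // conjcK eqxx.
(* Off the zeros of the Wronskian the unique root z is also simple, so the degree is at most 1. *)
have small z : S z -> ~~ root (wronsk N D) z -> (size (N - conjc z *: D)%R <= 2)%N.
  move=> Sz Wz; have [Dz ez] := hS _ Sz.
  set r := N - conjc z *: D.
  have rz : root r z by rewrite rootE hornerD hornerN hornerZ ez subrr.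
  have dr : ~~ root r^`() z.
    apply: contra Wz => dr; rewrite -(wronskBl (conjc z)) rootE /wronsk.
    by rewrite hornerD hornerN !hornerM (rootP dr) (rootP rz) !mul0r subrr.
  have r0 : r != 0 by apply: contraNneq dr => ->; rewrite deriv0 root0.
  have [rs er] := closed_field_poly_normal r.
  have lr : lead_coef r != 0 by rewrite lead_coef_eq0.
  have rsz y : y \in rs -> y = z.
    by move=> yrs; apply: uniq_root => //; rewrite -/r er rootZ // root_prod_XsubC.
  rewrite er size_scale // size_prod_XsubC ltnS leqNgt; apply: contra dr.
  case: rs er rsz => [|y1 [|y2 t]] //= er rsz _.
  have [e1 e2] : y1 = z /\ y2 = z by split; apply: rsz; rewrite !inE eqxx ?orbT.
  rewrite er !big_cons e1 e2 derivZ rootZ // derivM derivXsubC mul1r -mulrDr.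
  by rewrite rootM root_XsubC eqxx.
(* For two such points the polynomials N - conj(z) D have degree at most 1, and they span both N and
   D. *)
have [z1 S1 W1] := dS _ W0.
have [|z2 S2] := dS (wronsk N D * ('X - z1%:P)); first by rewrite mulf_neq0 ?polyXsubC_eq0.
rewrite rootM negb_or root_XsubC => /andP[W2 z12].
have [s1 s2] := (small _ S1 W1, small _ S2 W2).
have sD2 : (size D <= 2)%N.
  have k0 : conjc z2 - conjc z1 != 0.
    by rewrite subr_eq0 (inj_eq (can_inj (@conjcK R))).
  rewrite -(size_scale D k0).
  have -> : (conjc z2 - conjc z1) *: D = (N - conjc z1 *: D) - (N - conjc z2 *: D).
    by rewrite scalerBl opprB [RHS]addrC addrA subrK.
  by rewrite (leq_trans (size_polyD _ _)) // geq_max size_polyN s1 s2.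
split=> //.
rewrite -(subrK (conjc z1 *: D) N) (leq_trans (size_polyD _ _)) // geq_max s1.
by rewrite (leq_trans (size_scale_leq _ _)).
Qed.

(** Once N/D is in lowest terms, conj z (a z + b) = c z + d; its real and imaginary parts are both
    circle equations, and both are trivial only when a = b = 0. *)
Lemma schwarz_circle (S : set C) (N D : {poly C}) : zdense S ->
  (forall z, S z -> D.[z] != 0 /\ conjc z * D.[z] = N.[z]) ->
  exists al be ga de, 0 < be ^+ 2 + ga ^+ 2 - 4 * al * de /\
    forall z, S z -> circle_eq al be ga de z.
Proof.
move=> dS hS.
have [z0 S0 _] := dS 1 (oner_neq0 _).
have [z1 S1 z10] := dS ('X - z0%:P) (negbT (polyXsubC_eq0 _)).
rewrite root_XsubC in z10.
have D0 : D != 0.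
  have [Dz _] := hS _ S0; by apply: contraNneq Dz => ->; rewrite horner0.
have g0 : gcdp N D != 0 by rewrite gcdp_eq0 negb_and D0 orbT.
pose N' := N %/ gcdp N D; pose D' := D %/ gcdp N D.
have eN : N = N' * gcdp N D by rewrite divpK // dvdp_gcdl.
have eD : D = D' * gcdp N D by rewrite divpK // dvdp_gcdr.
have hS' z : S z -> D'.[z] != 0 /\ conjc z * D'.[z] = N'.[z].
  move=> /hS[Dz e].
  have ez (p r s : {poly C}) : p = r * s -> p.[z] = r.[z] * s.[z].
    by move=> ->; rewrite hornerM.
  move: Dz e; rewrite (ez _ _ _ eD) (ez _ _ _ eN) mulf_eq0 negb_or.
  by move=> /andP[d0 g]; rewrite mulrA => e; split=> //; exact: (mulIf g).
have c' : coprimep N' D' by apply: coprimep_div_gcd; rewrite D0 orbT.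
have [sN sD] := schwarz_degree1 dS c' hS'.
have lin (p : {poly C}) z : (size p <= 2)%N -> p.[z] = p`_1 * z + p`_0.
  by move=> sp; rewrite (horner_coef_wide _ sp) !big_ord_recl big_ord0 /= expr0 expr1 mulr1 addr0 addrC.
have D'0 : ~ (D'`_1 = 0 /\ D'`_0 = 0).
  by move=> [d1 d0]; have [] := hS' _ S0; rewrite lin // d1 d0 mul0r addr0 eqxx.
have {}hS' z : S z -> conjc z * (D'`_1 * z + D'`_0) = N'`_1 * z + N'`_0.
  by move=> /hS'[_]; rewrite !lin.
move: D'0 hS'; move: D'`_1 D'`_0 N'`_1 N'`_0.
move=> [a1 a2] [b1 b2] [c1 c2] [d1 d2] nz hS'.
have e1 z : S z -> circle_eq a1 (b1 - c1) (b2 + c2) (- d1) z.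
  case: z => x y /hS'; rewrite /circle_eq /= => -[e _]; lra.
have e2 z : S z -> circle_eq a2 (b2 - c2) (- b1 - c1) (- d2) z.
  case: z => x y /hS'; rewrite /circle_eq /= => -[_ e]; lra.
have [|h] := boolP [&& a1 == 0, b1 - c1 == 0, b2 + c2 == 0 & - d1 == 0]; last first.
  exists a1, (b1 - c1), (b2 + c2), (- d1); split=> //.
  by apply: (circle_discr_gt0 h z10); exact: e1.
have [|h _] := boolP [&& a2 == 0, b2 - c2 == 0, - b1 - c1 == 0 & - d2 == 0]; last first.
  exists a2, (b2 - c2), (- b1 - c1), (- d2); split=> //.
  by apply: (circle_discr_gt0 h z10); exact: e2.
move=> /and4P[/eqP h1 /eqP h2 /eqP h3 _] /and4P[/eqP k1 /eqP k2 /eqP k3 _].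
exfalso; apply: nz; split; congr Complex; lra.
Qed.

End Circle.

(** * Real-rootedness *)

Section RealRooted.
Variable R : realType.
Local Notation C := R[i].
Local Notation toC := (real_complex R).
Local Notation Re := (@complex.Re R).
Local Notation Im := (@complex.Im R).
Local Notation normc := (@ComplexField.Normc.normc R).
Local Notation normcM := (@ComplexField.Normc.normcM R).

Lemma normc_ge_Im (z : C) : `|Im z| <= normc z.
Proof.
case: z => x y /=; rewrite -sqrtr_sqr ler_sqrt ?addr_ge0 ?sqr_ge0 //.
by rewrite lerDr sqr_ge0.
Qed.

Lemma normc_ge0 (z : C) : 0 <= normc z.
Proof. by apply: le_trans (normc_ge_Im z). Qed.

Lemma normc_gt0 (z : C) : z != 0 -> 0 < normc z.
Proof.
move=> z0; rewrite lt_neqAle normc_ge0 andbT eq_sym.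
by apply: contraNneq z0 => /ComplexField.Normc.eq0_normc ->.
Qed.

Lemma normc_real (x : R) : normc (toC x) = `|x|.
Proof. by rewrite /= expr0n addr0 sqrtr_sqr. Qed.

(** Factor by factor: |t1 - z| <= |t1 - t0| + |t0 - z|, while |t0 - z| >= |Im t0| for real z. *)
Lemma normc_prod_ratio (t0 t1 : C) (s : seq C) : Im t0 != 0 ->
  (forall z, z \in s -> Im z = 0) ->
  normc (\prod_(z <- s) (t1 - z)) <=
    (1 + normc (t1 - t0) / `|Im t0|) ^+ size s * normc (\prod_(z <- s) (t0 - z)).
Proof.
move=> y0; set B := 1 + _.
have y_gt0 : 0 < `|Im t0| by rewrite normr_gt0.
have B0 : 0 <= B by rewrite addr_ge0 // divr_ge0 ?normc_ge0.
elim: s => [|z s IH] hs; first by rewrite !big_nil expr0 mul1r.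
rewrite !big_cons !normcM /= exprS mulrACA ler_pM ?normc_ge0 //; last first.
  by apply: IH => w ws; apply: hs; rewrite inE ws orbT.
have -> : t1 - z = (t1 - t0) + (t0 - z) by rewrite addrA subrK.
rewrite (le_trans (le_normcD _ _)) // mulrDl mul1r addrC lerD2l.
rewrite -mulrA ler_peMr ?normc_ge0 // mulrC ler_pdivlMr // mul1r.
have := normc_ge_Im (t0 - z); have := hs z (mem_head _ _).
by case: (t0) (z) => [a b] [c d] /= ->; rewrite subr0.
Qed.

(* For generic c' near c all roots of p - c' q are real, so that its value at a
   root t0 of p - c q with Im t0 <> 0 controls its value at a real point t1;
   the former tends to 0 with c' - c, the latter does not. *)
Lemma real_rooted_limit (p q T : {poly C}) n :
  (size p <= n.+1)%N -> (size q <= n.+1)%N ->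
  (forall x, root p x -> ~~ root q x) -> (p`_n = 0 -> q`_n != 0) ->
  (forall c : R, p - toC c *: q != 0) -> T != 0 ->
  (forall (c : R) z, -1 <= c <= 1 -> root (p - toC c *: q) z -> ~~ root T z -> Im z = 0) ->
  forall (c : R) z, -1 <= c <= 1 -> root (p - toC c *: q) z -> Im z = 0.
Proof.
move=> sp sq cpq top nz T0 hT c t0 /andP[c1 c2] rt0; apply/eqP/negPn/negP => y0.
set r := p - toC c *: q in rt0.
have [x _ rx] := exists_real_nonroot (nz c) (ltr01 : 0 < 1 :> R).
pose t1 := toC x; rewrite -/r -/t1 rootE in rx.
pose B := 1 + normc (t1 - t0) / `|Im t0|.
pose mu := B ^+ n * normc q.[t0] + normc q.[t1].
have B1 : 1 <= B by rewrite lerDl divr_ge0 ?normc_ge0.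
have mu0 : 0 <= mu by rewrite addr_ge0 ?mulr_ge0 ?exprn_ge0 ?normc_ge0 ?(le_trans _ B1).
have rho0 : 0 < normc r.[t1] := normc_gt0 rx.
(* The estimate below yields |r(t1)| <= |c' - c| mu; [eta] makes the right side smaller than
   |r(t1)|, and the added 1 covers mu = 0. *)
pose eta := normc r.[t1] / (mu + 1).
have eta0 : 0 < eta by rewrite divr_gt0 // ltr_wpDl.
have [c' [c'1 c'2 hroots]] : exists c' : R, [/\ -1 <= c' <= 1, `|c' - c| < eta &
    forall z, root (p - toC c' *: q) z -> Im z = 0].
  (* A one-sided neighbourhood of c, on the side that stays within [-1, 1]. *)
  have [l [u [lu l1 u1 hl]]] : exists l u : R, [/\ l < u, -1 <= l, u <= 1 &
      forall c', l < c' < u -> `|c' - c| < eta].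
    have [cl|cl] := ltP c 1.
      exists c, (Num.min 1 (c + eta)); split; rewrite ?lt_min ?cl ?ge_min ?lexx //.
        by rewrite ltrDl.
      move=> c' /andP[h1]; rewrite lt_min => /andP[_ h2].
      by rewrite ger0_norm ?subr_ge0 ?ltW // ltrBlDl.
    exists (Num.max (-1) (c - eta)), c; split; rewrite ?gt_max ?le_max ?lexx //.
      by apply/andP; split; lra.
    move=> c' /andP[]; rewrite gt_max => /andP[_ h1] h2.
    by rewrite ler0_norm ?subr_le0 ?ltW //; lra.
  have [c' [lcu _ hc']] := generic_fiber cpq top T0 lu.
  exists c'; have c'1 : -1 <= c' <= 1 by case/andP: lcu => *; apply/andP; split; lra.
  by split; rewrite ?hl // => z rz; apply: (hT c') => //; exact: hc'.
have re : p - toC c' *: q = r - toC (c' - c) *: q.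
  by rewrite /r rmorphB scalerBl opprB addrA subrK.
set e := c' - c in c'2 re.
have [rs er] := closed_field_poly_normal (p - toC c' *: q).
have lr : lead_coef (p - toC c' *: q) != 0 by rewrite lead_coef_eq0.
have srs : (size rs <= n)%N.
  have : (size (p - toC c' *: q)%R <= n.+1)%N.
    by rewrite (leq_trans (size_polyD _ _)) // geq_max sp size_polyN (leq_trans (size_scale_leq _ _)).
  by rewrite er size_scale // size_prod_XsubC.
have rs_real z : z \in rs -> Im z = 0.
  by move=> zrs; apply: hroots; rewrite er rootZ // root_prod_XsubC.
have hor t : (r - toC e *: q).[t] = lead_coef (p - toC c' *: q) * \prod_(z <- rs) (t - z).
  rewrite -re {1}er hornerZ horner_prod; congr (_ * _).
  by apply: eq_bigr => z _; rewrite hornerXsubC.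
(* As r(t0) = 0, the perturbed polynomial is -e q(t0) at t0, small with e; real-rootedness passes
   this bound on to t1. *)
have key : normc (r - toC e *: q).[t1] <= B ^+ n * (`|e| * normc q.[t0]).
  have -> : `|e| * normc q.[t0] = normc (r - toC e *: q).[t0].
    rewrite hornerD hornerN hornerZ (rootP rt0) sub0r -mulNr normcM.
    by congr (_ * _); rewrite -rmorphN normc_real normrN.
  rewrite !hor !normcM mulrCA ler_wpM2l ?normc_ge0 //.
  rewrite (le_trans (normc_prod_ratio _ y0 rs_real)) // ler_wpM2r ?normc_ge0 //.
  by rewrite ler_weXn2l.
have : normc r.[t1] <= `|e| * mu.
  have -> : r.[t1] = (r - toC e *: q).[t1] + toC e * q.[t1].
    by rewrite hornerD hornerN hornerZ subrK.
  rewrite (le_trans (le_normcD _ _)) // mulrDr normcM normc_real lerD2r.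
  by rewrite (le_trans key) // mulrCA.
apply/negP; rewrite -ltNge.
rewrite (@le_lt_trans _ _ (`|e| * (mu + 1))) //.
  by rewrite ler_wpM2l // lerDl.
by move: c'2; rewrite /eta ltr_pdivlMr // ltr_wpDl.
Qed.

(** p/q is real at infinitely many real points, so it equals its conjugate; by coprimality conj q =
    k q and conj p = k p. *)
Lemma real_scaling (p q : {poly C}) : coprimep p q -> q != 0 ->
  zdense [set t | Im t = 0 /\ exists c : R, root (p - toC c *: q) t] ->
  exists k (pr qr : {poly R}), [/\ k != 0, p = k *: map_poly toC pr & q = k *: map_poly toC qr].
Proof.
move=> cpq q0 dS.
pose pj := map_poly (@conjc R) p; pose qj := map_poly (@conjc R) q.
have epq : p * qj = pj * q.
  apply: (zdense_eq dS) => t /= [t0 [c]]; rewrite rootE hornerD hornerN hornerZ subr_eq0.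
  move=> /eqP e; rewrite !hornerM.
  have et : t = conjc t by case: (t) t0 => x y /= ->; rewrite oppr0.
  rewrite /pj /qj et !map_conjc_horner -et e conjcM conjc_real.
  by rewrite mulrAC.
have sqj : size qj = size q by rewrite size_map_poly.
have dvd : q %| qj.
  by rewrite -(@Gauss_dvdpr _ qj p) 1?coprimep_sym // epq dvdp_mull.
have /eqpP[[k1 k2] /= /andP[k10 k20] ek] : q %= qj by rewrite -dvdp_size_eqp // sqj.
pose k := k1 / k2.
have k0 : k != 0 by rewrite mulf_neq0 // invr_eq0.
have eqj : qj = k *: q by rewrite /k mulrC -scalerA ek scalerA mulVf // scale1r.
have epj : pj = k *: p.
  by apply: (mulIf q0); rewrite -epq eqj -scalerAr -scalerAl.
(* The leading coefficient satisfies conj l = k l as well, so division by l cancels the factor k and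
   leaves real coefficients. *)
pose l := lead_coef q; have l0 : l != 0 by rewrite lead_coef_eq0.
have coefJ (f : {poly C}) i : (map_poly (@conjc R) f)`_i = conjc f`_i.
  exact: coef_map.
have lj : conjc l = k * l by rewrite /l lead_coefE -coefJ -/qj eqj coefZ.
have real_part (f : {poly C}) : map_poly (@conjc R) f = k *: f ->
    f = l *: map_poly toC (map_poly Re (l^-1 *: f)).
  move=> ef; apply/polyP => i; rewrite coefZ coef_map coef_map_id0 // coefZ.
  have ei : conjc f`_i = k * f`_i by rewrite -coefJ ef coefZ.
  have : conjc (l^-1 * f`_i) = l^-1 * f`_i.
    by rewrite conjcM conjc_inv lj ei invfM mulrACA mulVf // mul1r.
  move=> ec; rewrite -[LHS](mulVKf l0); move: ec; case: (l^-1 * f`_i) => x y /(congr1 Im) /= e.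
  have /eqP : y *+ 2 = 0 by rewrite mulr2n -{1}e addNr.
  by rewrite mulrn_eq0 /= => /eqP ->.
by exists l, (map_poly Re (l^-1 *: p)), (map_poly Re (l^-1 *: q)); split=> //; exact: real_part.
Qed.

End RealRooted.

(** * Parametrisation of the circle *)

Lemma mobius_surj (R : realType) (a b c d : R[i]) z :
  c != 0 -> a * d - b * c != 0 -> z <> Some (a / c) ->
  exists t, mobius a b c d t = z.
Proof.
move=> c0 det0; case: z => [z|] hz; last first.
  exists (- d / c); rewrite /mobius ifF //; apply/negbF/eqP.
  by rewrite hornerD hornerZ hornerX hornerC [c * _]mulrC divfK // addNr.
have k0 : c * z - a != 0.
  apply/eqP => k0; apply: hz; congr Some; apply: (mulfI c0).
  by rewrite [RHS]mulrC divfK //; apply/eqP; rewrite -subr_eq0 k0.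
have det_N : - (a * d - b * c) != 0 by rewrite oppr_eq0.
exists ((b - d * z) / (c * z - a)); rewrite /mobius.
have eD : (c *: 'X + d%:P).[(b - d * z) / (c * z - a)] = - (a * d - b * c) / (c * z - a).
  rewrite hornerD hornerZ hornerX hornerC; apply: (mulIf k0).
  by rewrite mulrDl mulrA !divfK //; ring.
have eN : (a *: 'X + b%:P).[(b - d * z) / (c * z - a)] = - (a * d - b * c) * z / (c * z - a).
  rewrite hornerD hornerZ hornerX hornerC; apply: (mulIf k0).
  by rewrite mulrDl mulrA !divfK //; ring.
have D0 : - (a * d - b * c) / (c * z - a) != 0 by rewrite mulf_neq0 ?invr_eq0.
rewrite eD D0; congr Some; rewrite eN; move: D0.
move: (- (a * d - b * c)) (c * z - a) => e k D0.
by rewrite [e * z / k]mulrAC [e / k * z]mulrC mulfK.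
Qed.

Section CircleParam.
Variable R : realType.
Local Notation C := R[i].
Local Notation toC := (real_complex R).
Local Notation Re := (@complex.Re R).
Local Notation Im := (@complex.Im R).
Variables (al be ga de x0 y0 : R).
Local Notation zs := (Complex x0 y0).
Hypothesis discr : 0 < be ^+ 2 + ga ^+ 2 - 4 * al * de.
Hypothesis zs_circ : circle_eq al be ga de zs.

Definition on_circle (z : CP1 R) : Prop :=
  match z with Some z => circle_eq al be ga de z | None => al = 0 end.

(** [(lam1, lam2)] is the gradient of the circle equation at [zs]; its squared norm is the
    discriminant. *)
Definition lam1 := 2 * al * x0 + be.
Definition lam2 := 2 * al * y0 + ga.

Lemma lam_gt0 : 0 < lam1 ^+ 2 + lam2 ^+ 2.
Proof.
have := zs_circ; rewrite /circle_eq /= => e.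
have -> : lam1 ^+ 2 + lam2 ^+ 2 = be ^+ 2 + ga ^+ 2 - 4 * al * de +
  4 * al * (al * (x0 ^+ 2 + y0 ^+ 2) + be * x0 + ga * y0 + de).
  by rewrite /lam1 /lam2; ring.
by rewrite e mulr0 addr0.
Qed.

(* The coordinate t |-> zs + (lam1 + i lam2) / (i t - al) sends infinity to zs
   and the real line to the rest of the circle. *)
Definition mob_a : C := Complex (- y0) x0.
Definition mob_b : C := Complex (lam1 - al * x0) (lam2 - al * y0).
Definition mob_c : C := Complex 0 1.
Definition mob_d : C := Complex (- al) 0.

Local Notation mob := (mobius mob_a mob_b mob_c mob_d).

Lemma mob_c_neq0 : mob_c != 0.
Proof. by rewrite eq_complex /= oner_eq0 andbF. Qed.

Lemma mob_det_neq0 : mob_a * mob_d - mob_b * mob_c != 0.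
Proof.
have -> : mob_a * mob_d - mob_b * mob_c = Complex lam2 (- lam1).
  by apply/eqP; rewrite eq_complex /=; apply/andP; split; apply/eqP; ring.
rewrite eq_complex /= oppr_eq0; apply/negP => /andP[/eqP e1 /eqP e2].
by have := lam_gt0; rewrite e1 e2 !expr0n addr0 ltxx.
Qed.

Lemma mob_center : mob_a / mob_c = zs.
Proof.
apply: (mulIf mob_c_neq0); rewrite divfK ?mob_c_neq0 //.
by apply/eqP; rewrite eq_complex /=; apply/andP; split; apply/eqP; ring.
Qed.

(** For t = s + i tau, the denominator i t - al is p + i s. *)
Lemma mobE s tau : mob (Complex s tau) =
  let p := - tau - al in
  if (p == 0) && (s == 0) then None else
  Some (Complex (x0 + (lam1 * p + lam2 * s) / (p ^+ 2 + s ^+ 2))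
                (y0 + (lam2 * p - lam1 * s) / (p ^+ 2 + s ^+ 2))).
Proof.
move=> /=; set p := - tau - al.
have eD : (mob_c *: 'X + mob_d%:P).[Complex s tau] = Complex p s.
  rewrite hornerD hornerZ hornerX hornerC.
  by apply/eqP; rewrite eq_complex /=; apply/andP; split; apply/eqP; rewrite /p; ring.
rewrite /mobius eD eq_complex /=.
case: (boolP ((p == 0) && (s == 0))) => //= h; congr Some.
have n0 : p ^+ 2 + s ^+ 2 != 0.
  rewrite paddr_eq0 ?sqr_ge0 // !expf_eq0 /=.
  exact: h.
have D0 : Complex p s != 0 by rewrite eq_complex /= h.
apply: (mulIf D0); rewrite divfK // hornerD hornerZ hornerX hornerC.
apply/eqP; rewrite eq_complex /=.
have -> : tau = - p - al by rewrite /p; ring.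
by apply/andP; split; apply/eqP; field.
Qed.

Lemma on_circle_mob t : on_circle (mob t) <-> Im t = 0.
Proof.
case: t => s tau; rewrite mobE /=; case: ifP => [/andP[/eqP p0 /eqP s0] /=|h /=].
  by split=> h; lra.
set p := - tau - al in h *.
have n0 : 0 < p ^+ 2 + s ^+ 2.
  rewrite lt_neqAle addr_ge0 ?sqr_ge0 // andbT eq_sym.
  rewrite paddr_eq0 ?sqr_ge0 // !expf_eq0 /=.
  by apply: contraFN h => /andP[-> ->].
rewrite /circle_eq /=; set e := _ + de.
(* The circle equation at the image is -tau times a positive factor, plus the equation at [zs],
   which is 0. *)
have -> : e = - tau * ((lam1 ^+ 2 + lam2 ^+ 2) / (p ^+ 2 + s ^+ 2)) +
  (al * (x0 ^+ 2 + y0 ^+ 2) + be * x0 + ga * y0 + de).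
  have -> : tau = - p - al by rewrite /p; ring.
  by rewrite /e /lam1 /lam2; field; rewrite gt_eqF.
have := zs_circ; rewrite /circle_eq /= => ->; rewrite addr0.
split=> [/eqP|->]; last by rewrite oppr0 mul0r.
by rewrite mulf_eq0 oppr_eq0 [X in _ || X]gt_eqF ?orbF ?divr_gt0 ?lam_gt0 // => /eqP.
Qed.

End CircleParam.

(** * Homeomorphisms *)

Local Open Scope classical_set_scope.

Lemma homeomorphic_image (X Y : topologicalType) (A : set X) (B : set Y)
    (f : X -> Y) (g : Y -> X) :
  (forall x, A x -> B (f x) /\ g (f x) = x) ->
  (forall y, B y -> A (g y) /\ f (g y) = y) ->
  (forall x, A x -> {for x, continuous f}) ->
  (forall y, B y -> {for y, continuous g}) ->
  homeomorphic A B.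
Proof.
move=> hf hg cf cg; exists f, g; split.
- by move=> x /set_mem /hf[] h _; exact: mem_set.
- by move=> y /set_mem /hg[] h _; exact: mem_set.
- by move=> x /set_mem /hf[].
- by move=> y /set_mem /hg[].
- by split; apply: continuous_in_subspaceT => x /set_mem; [exact: cf|exact: cg].
Qed.

Lemma continuous_pair (X Y Z : topologicalType) (f : X -> Y) (g : X -> Z) x :
  {for x, continuous f} -> {for x, continuous g} ->
  {for x, continuous (fun y => (f y, g y))}.
Proof. by move=> cf cg; exact: (cvg_pair cf cg). Qed.

(** * Plane sections of the unit sphere are circles *)

Section Frame.
Variable R : realType.

Lemma cont3_1 (x : R3 R) : {for x, continuous (fun y : R3 R => y.1.1 : R)}.
Proof.
apply: (@continuous_comp _ _ _ (fun y : R3 R => y.1) fst); exact: cvg_fst.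
Qed.

Lemma cont3_2 (x : R3 R) : {for x, continuous (fun y : R3 R => y.1.2 : R)}.
Proof.
apply: (@continuous_comp _ _ _ (fun y : R3 R => y.1) snd); [exact: cvg_fst|exact: cvg_snd].
Qed.

Lemma cont3_3 (x : R3 R) : {for x, continuous (fun y : R3 R => y.2 : R)}.
Proof. exact: cvg_snd. Qed.

Definition affine3 (k1 k2 k3 k0 : R) (y : R3 R) : R :=
  k1 * y.1.1 + k2 * y.1.2 + k3 * y.2 + k0.

Lemma affine3_continuous k1 k2 k3 k0 : continuous (affine3 k1 k2 k3 k0).
Proof.
move=> x; apply: cvgD; last exact: cvg_cst.
apply: cvgD; first apply: cvgD.
- by apply: cvgM; [exact: cvg_cst|exact: cont3_1].
- by apply: cvgM; [exact: cvg_cst|exact: cont3_2].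
- by apply: cvgM; [exact: cvg_cst|exact: cont3_3].
Qed.

Definition affine2 (k1 k2 k0 : R) (y : R * R) : R := k1 * y.1 + k2 * y.2 + k0.

Lemma affine2_continuous k1 k2 k0 : continuous (affine2 k1 k2 k0).
Proof.
move=> x; apply: cvgD; last exact: cvg_cst.
by apply: cvgD; apply: cvgM; [exact: cvg_cst|exact: cvg_fst|exact: cvg_cst|exact: cvg_snd].
Qed.

(** For orthonormal a, u the matrix with rows a, u, a x u is orthogonal, so its columns are
    orthonormal too. This lemma and the next give the first column and its product with the second;
    cyclic permutation gives the others. *)
Lemma frame_diag (a1 a2 a3 u1 u2 u3 : R) :
  a1 ^+ 2 + a2 ^+ 2 + a3 ^+ 2 = 1 -> u1 ^+ 2 + u2 ^+ 2 + u3 ^+ 2 = 1 ->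
  a1 * u1 + a2 * u2 + a3 * u3 = 0 ->
  a1 ^+ 2 + u1 ^+ 2 + (a2 * u3 - a3 * u2) ^+ 2 = 1.
Proof.
move=> ha hu h.
have -> : (a2 * u3 - a3 * u2) ^+ 2 =
  (a2 ^+ 2 + a3 ^+ 2) * (u2 ^+ 2 + u3 ^+ 2) - (a2 * u2 + a3 * u3) ^+ 2 by ring.
have -> : a2 ^+ 2 + a3 ^+ 2 = 1 - a1 ^+ 2 by rewrite -ha; ring.
have -> : u2 ^+ 2 + u3 ^+ 2 = 1 - u1 ^+ 2 by rewrite -hu; ring.
have -> : a2 * u2 + a3 * u3 = - (a1 * u1) by apply/eqP; rewrite -addr_eq0 addrC addrA h.
by ring.
Qed.

Lemma frame_off (a1 a2 a3 u1 u2 u3 : R) :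
  a1 ^+ 2 + a2 ^+ 2 + a3 ^+ 2 = 1 -> u1 ^+ 2 + u2 ^+ 2 + u3 ^+ 2 = 1 ->
  a1 * u1 + a2 * u2 + a3 * u3 = 0 ->
  a1 * a2 + u1 * u2 + (a2 * u3 - a3 * u2) * (a3 * u1 - a1 * u3) = 0.
Proof.
move=> ha hu h.
have e3 : a3 * u3 = - (a1 * u1 + a2 * u2) by apply/eqP; rewrite -addr_eq0 addrC h.
have ea : a3 ^+ 2 = 1 - a1 ^+ 2 - a2 ^+ 2 by rewrite -ha; ring.
have eu : u3 ^+ 2 = 1 - u1 ^+ 2 - u2 ^+ 2 by rewrite -hu; ring.
have -> : (a2 * u3 - a3 * u2) * (a3 * u1 - a1 * u3) =
  - (a1 * a2 * u3 ^+ 2) - u1 * u2 * a3 ^+ 2 + (a3 * u3) * (a2 * u1 + a1 * u2) by ring.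
by rewrite e3 ea eu; ring.
Qed.

Definition sph_section (a1 a2 a3 h : R) : set (R3 R) :=
  [set X | X.1.1 ^+ 2 + X.1.2 ^+ 2 + X.2 ^+ 2 = 1 /\
           a1 * X.1.1 + a2 * X.1.2 + a3 * X.2 = h].

(** The section is the circle with centre h a and radius r = sqrt (1 - h^2) in the plane normal to
    a. The given point X0 fixes the first axis u, and v = a x u the second; both maps are then
    affine. *)
Lemma sph_section_homeo (a1 a2 a3 h : R) (X0 : R3 R) :
  a1 ^+ 2 + a2 ^+ 2 + a3 ^+ 2 = 1 -> h ^+ 2 < 1 ->
  sph_section a1 a2 a3 h X0 ->
  homeomorphic (sph_section a1 a2 a3 h) (@unit_circle R).
Proof.
case: X0 => [[w1 w2] w3] ha hh [/= hw hp].
pose r := Num.sqrt (1 - h ^+ 2).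
have r2 : r ^+ 2 = 1 - h ^+ 2 by rewrite sqr_sqrtr // subr_ge0 ltW.
have r0 : r != 0 by rewrite sqrtr_eq0 -ltNge subr_gt0.
pose u1 := (w1 - h * a1) / r; pose u2 := (w2 - h * a2) / r; pose u3 := (w3 - h * a3) / r.
have hu : u1 ^+ 2 + u2 ^+ 2 + u3 ^+ 2 = 1.
  have -> : u1 ^+ 2 + u2 ^+ 2 + u3 ^+ 2 =
    (w1 ^+ 2 + w2 ^+ 2 + w3 ^+ 2 - 2 * h * (a1 * w1 + a2 * w2 + a3 * w3)
     + h ^+ 2 * (a1 ^+ 2 + a2 ^+ 2 + a3 ^+ 2)) / r ^+ 2.
    by rewrite /u1 /u2 /u3; field.
  by rewrite hw hp ha r2; field; rewrite -r2 expf_neq0.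
have hau : a1 * u1 + a2 * u2 + a3 * u3 = 0.
  have -> : a1 * u1 + a2 * u2 + a3 * u3 =
    ((a1 * w1 + a2 * w2 + a3 * w3) - h * (a1 ^+ 2 + a2 ^+ 2 + a3 ^+ 2)) / r.
    by rewrite /u1 /u2 /u3; field.
  by rewrite hp ha mulr1 subrr mul0r.
clearbody u1 u2 u3.
have ha' : a2 ^+ 2 + a3 ^+ 2 + a1 ^+ 2 = 1 by rewrite -ha; ring.
have hu' : u2 ^+ 2 + u3 ^+ 2 + u1 ^+ 2 = 1 by rewrite -hu; ring.
have hau' : a2 * u2 + a3 * u3 + a1 * u1 = 0 by rewrite -hau; ring.
have ha'' : a3 ^+ 2 + a1 ^+ 2 + a2 ^+ 2 = 1 by rewrite -ha; ring.
have hu'' : u3 ^+ 2 + u1 ^+ 2 + u2 ^+ 2 = 1 by rewrite -hu; ring.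
have hau'' : a3 * u3 + a1 * u1 + a2 * u2 = 0 by rewrite -hau; ring.
have d1 := frame_diag ha hu hau; have d2 := frame_diag ha' hu' hau'.
have d3 := frame_diag ha'' hu'' hau''.
have o1 := frame_off ha hu hau; have o2 := frame_off ha' hu' hau'.
have o3 := frame_off ha'' hu'' hau''.
pose v1 := a2 * u3 - a3 * u2; pose v2 := a3 * u1 - a1 * u3; pose v3 := a1 * u2 - a2 * u1.
have hv : v1 ^+ 2 + v2 ^+ 2 + v3 ^+ 2 = 1.
  have : (a1 ^+ 2 + u1 ^+ 2 + v1 ^+ 2) + (a2 ^+ 2 + u2 ^+ 2 + v2 ^+ 2) +
    (a3 ^+ 2 + u3 ^+ 2 + v3 ^+ 2) = 1 + 1 + 1 by rewrite d1 d2 d3.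
  by move: ha hu; lra.
have hav : a1 * v1 + a2 * v2 + a3 * v3 = 0 by rewrite /v1 /v2 /v3; ring.
have huv : u1 * v1 + u2 * v2 + u3 * v3 = 0 by rewrite /v1 /v2 /v3; ring.
rewrite -/v1 in d1 o1 o3; rewrite -/v2 in d2 o1 o2; rewrite -/v3 in d3 o2 o3.
clearbody v1 v2 v3.
pose f (X : R3 R) : R * R := (affine3 (u1 / r) (u2 / r) (u3 / r) 0 X,
                              affine3 (v1 / r) (v2 / r) (v3 / r) 0 X).
pose g (s : R * R) : R3 R := ((affine2 (r * u1) (r * v1) (h * a1) s,
   affine2 (r * u2) (r * v2) (h * a2) s), affine2 (r * u3) (r * v3) (h * a3) s).
(* Expansion of a vector in the frame a, u, v. *)
have dec x1 x2 x3 : [/\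
  x1 = (a1 * x1 + a2 * x2 + a3 * x3) * a1 + (u1 * x1 + u2 * x2 + u3 * x3) * u1
       + (v1 * x1 + v2 * x2 + v3 * x3) * v1,
  x2 = (a1 * x1 + a2 * x2 + a3 * x3) * a2 + (u1 * x1 + u2 * x2 + u3 * x3) * u2
       + (v1 * x1 + v2 * x2 + v3 * x3) * v2 &
  x3 = (a1 * x1 + a2 * x2 + a3 * x3) * a3 + (u1 * x1 + u2 * x2 + u3 * x3) * u3
       + (v1 * x1 + v2 * x2 + v3 * x3) * v3].
  split.
  - transitivity (x1 * (a1 ^+ 2 + u1 ^+ 2 + v1 ^+ 2) + x2 * (a1 * a2 + u1 * u2 + v1 * v2)
      + x3 * (a3 * a1 + u3 * u1 + v3 * v1)); last by ring.
    by rewrite d1 o1 o3; ring.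
  - transitivity (x1 * (a1 * a2 + u1 * u2 + v1 * v2) + x2 * (a2 ^+ 2 + u2 ^+ 2 + v2 ^+ 2)
      + x3 * (a2 * a3 + u2 * u3 + v2 * v3)); last by ring.
    by rewrite d2 o1 o2; ring.
  - transitivity (x1 * (a3 * a1 + u3 * u1 + v3 * v1) + x2 * (a2 * a3 + u2 * u3 + v2 * v3)
      + x3 * (a3 ^+ 2 + u3 ^+ 2 + v3 ^+ 2)); last by ring.
    by rewrite d3 o2 o3; ring.
apply: (@homeomorphic_image _ _ _ _ f g).
- move=> [[x1 x2] x3] [/= hx hxp]; have [e1 e2 e3] := dec x1 x2 x3.
  rewrite hxp in e1 e2 e3.
  pose s := u1 * x1 + u2 * x2 + u3 * x3; pose t := v1 * x1 + v2 * x2 + v3 * x3.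
  have st : s ^+ 2 + t ^+ 2 = r ^+ 2.
    have : x1 * (h * a1 + s * u1 + t * v1) + x2 * (h * a2 + s * u2 + t * v2) +
           x3 * (h * a3 + s * u3 + t * v3) = 1 by rewrite -e1 -e2 -e3 -!expr2.
    have -> : x1 * (h * a1 + s * u1 + t * v1) + x2 * (h * a2 + s * u2 + t * v2) +
           x3 * (h * a3 + s * u3 + t * v3) =
      h * (a1 * x1 + a2 * x2 + a3 * x3) + s ^+ 2 + t ^+ 2 by rewrite /s /t; ring.
    by rewrite hxp r2 => <-; ring.
  rewrite /f /g /affine3 /affine2 /unit_circle /=; split.
    have -> : u1 / r * x1 + u2 / r * x2 + u3 / r * x3 + 0 = s / r by rewrite /s; field.
    have -> : v1 / r * x1 + v2 / r * x2 + v3 / r * x3 + 0 = t / r by rewrite /t; field.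
    by rewrite !expr_div_n -mulrDl st divff // expf_neq0.
  congr (_, _, _).
  + by rewrite [RHS]e1; field.
  + by rewrite [RHS]e2; field.
  + by rewrite [RHS]e3; field.
- move=> [s t]; rewrite /unit_circle /= => st.
  rewrite /f /g /affine3 /affine2 /sph_section /=; split; first split.
  + transitivity (r ^+ 2 * (s ^+ 2 * (u1 ^+ 2 + u2 ^+ 2 + u3 ^+ 2) +
        t ^+ 2 * (v1 ^+ 2 + v2 ^+ 2 + v3 ^+ 2) + 2 * s * t * (u1 * v1 + u2 * v2 + u3 * v3))
      + 2 * h * r * (s * (a1 * u1 + a2 * u2 + a3 * u3) + t * (a1 * v1 + a2 * v2 + a3 * v3))
      + h ^+ 2 * (a1 ^+ 2 + a2 ^+ 2 + a3 ^+ 2)); first by ring.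
    rewrite hu hv huv hau hav ha r2 !mulr0 !addr0 !mulr1 st mulr1.
    by ring.
  + transitivity (r * (s * (a1 * u1 + a2 * u2 + a3 * u3) + t * (a1 * v1 + a2 * v2 + a3 * v3))
      + h * (a1 ^+ 2 + a2 ^+ 2 + a3 ^+ 2)); first by ring.
    by rewrite hau hav ha; ring.
  + congr (_, _).
    * transitivity (s * (u1 ^+ 2 + u2 ^+ 2 + u3 ^+ 2) + t * (u1 * v1 + u2 * v2 + u3 * v3)
        + h / r * (a1 * u1 + a2 * u2 + a3 * u3)); first by field.
      by rewrite hu huv hau; ring.
    * transitivity (t * (v1 ^+ 2 + v2 ^+ 2 + v3 ^+ 2) + s * (u1 * v1 + u2 * v2 + u3 * v3)
        + h / r * (a1 * v1 + a2 * v2 + a3 * v3)); first by field.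
      by rewrite hv huv hav; ring.
- by move=> X _; apply: continuous_pair; exact: affine3_continuous.
- move=> s _; apply: (@continuous_pair _ (R * R)%type R); last exact: affine2_continuous.
  by apply: continuous_pair; exact: affine2_continuous.
Qed.

End Frame.

Section SphericalCurves.
Variable R : realType.
Local Notation C := R[i].

Lemma sqr_norm1_gt0 (x y : R) : 0 < x ^+ 2 + y ^+ 2 + 1.
Proof. by rewrite ltr_wpDl // addr_ge0 ?sqr_ge0. Qed.

Lemma sphere_of_unit (z : CP1 R) : let X := sphere_of z in
  X.1.1 ^+ 2 + X.1.2 ^+ 2 + X.2 ^+ 2 = 1.
Proof.
case: z => [[x y]|] /=; last by rewrite expr1n !expr0n !addr0.
by field; rewrite gt_eqF ?sqr_norm1_gt0.
Qed.

Lemma sphere_of_surj (X : R3 R) : X.1.1 ^+ 2 + X.1.2 ^+ 2 + X.2 ^+ 2 = 1 ->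
  exists z : CP1 R, sphere_of z = X.
Proof.
case: X => [[x1 x2] x3] /= hX; have [x1E|x1N] := eqVneq x1 1.
  exists None; rewrite /= x1E; congr (_, _, _); move: hX; rewrite x1E expr1n.
    by move/eqP; rewrite -addrA -subr_eq0 addrAC subrr add0r paddr_eq0 ?sqr_ge0 // !expf_eq0 => /andP[/eqP].
  by move/eqP; rewrite -addrA -subr_eq0 addrAC subrr add0r paddr_eq0 ?sqr_ge0 // !expf_eq0 => /andP[_ /eqP].
have d0 : 1 - x1 != 0 by rewrite subr_eq0 eq_sym.
exists (Some (Complex (x2 / (1 - x1)) (x3 / (1 - x1)))) => /=.
have -> : (x2 / (1 - x1)) ^+ 2 + (x3 / (1 - x1)) ^+ 2 = (1 + x1) / (1 - x1).
  have -> : (x2 / (1 - x1)) ^+ 2 + (x3 / (1 - x1)) ^+ 2 =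
    (x1 ^+ 2 + x2 ^+ 2 + x3 ^+ 2 - x1 ^+ 2) / (1 - x1) ^+ 2 by field.
  by rewrite hX; field.
have -> : (1 + x1) / (1 - x1) + 1 = 2 / (1 - x1) by field.
congr (_, _, _); field; rewrite ?d0 ?pnatr_eq0 //.
Qed.

Lemma sphere_of_plane (al be ga de : R) (z : CP1 R) : let X := sphere_of z in
  on_circle al be ga de z <->
  (al - de) * X.1.1 + be * X.1.2 + ga * X.2 + (al + de) = 0.
Proof.
case: z => [[x y]|] /=; last by split=> h; lra.
have w0 := sqr_norm1_gt0 x y; rewrite /circle_eq /=.
set w := x ^+ 2 + y ^+ 2 + 1 in w0 *.
have -> : (al - de) * ((x ^+ 2 + y ^+ 2 - 1) / w) + be * (2 * x / w) +
    ga * (2 * y / w) + (al + de) =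
    2 / w * (al * (x ^+ 2 + y ^+ 2) + be * x + ga * y + de).
  by rewrite /w; field; rewrite gt_eqF.
split=> [->|/eqP]; first by rewrite mulr0.
by rewrite mulf_eq0 gt_eqF ?divr_gt0 // => /eqP.
Qed.

Variables (al be ga de x0 y0 : R).
Local Notation zs := (Complex x0 y0).
Hypothesis discr : 0 < be ^+ 2 + ga ^+ 2 - 4 * al * de.
Hypothesis zs_circ : circle_eq al be ga de zs.
Local Notation l1 := (lam1 al be x0).
Local Notation l2 := (lam2 al ga y0).
Local Notation mob := (mobius (mob_a x0 y0) (mob_b al be ga x0 y0) (mob_c R) (mob_d al)).

Lemma circle_homeo :
  CP1_homeomorphic [set z | on_circle al be ga de z] (@unit_circle R).
Proof.
pose m := Num.sqrt ((al - de) ^+ 2 + be ^+ 2 + ga ^+ 2).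
(* The squared normal of the plane exceeds (al + de)^2 by the discriminant, so the plane is at
   distance less than 1 from the origin. *)
have NE : (al - de) ^+ 2 + be ^+ 2 + ga ^+ 2 =
    (be ^+ 2 + ga ^+ 2 - 4 * al * de) + (al + de) ^+ 2 by ring.
have N0 : 0 < (al - de) ^+ 2 + be ^+ 2 + ga ^+ 2.
  by rewrite NE ltr_pwDl ?sqr_ge0.
have m2 : m ^+ 2 = (al - de) ^+ 2 + be ^+ 2 + ga ^+ 2 by rewrite sqr_sqrtr // ltW.
have m0 : m != 0 by rewrite sqrtr_eq0 -ltNge.
have plane (z : CP1 R) : let X := sphere_of z in on_circle al be ga de z <->
    (al - de) / m * X.1.1 + be / m * X.1.2 + ga / m * X.2 = - ((al + de) / m).
  move=> X; rewrite sphere_of_plane -/X.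
  have -> : (al - de) / m * X.1.1 + be / m * X.1.2 + ga / m * X.2 =
    ((al - de) * X.1.1 + be * X.1.2 + ga * X.2 + (al + de)) / m - (al + de) / m.
    by field.
  split=> [->|/eqP]; first by rewrite mul0r sub0r.
  rewrite -subr_eq0 opprK subrK mulf_eq0 invr_eq0 (negPf m0) orbF => /eqP //.
rewrite /CP1_homeomorphic.
have -> : sphere_of (R := R) @` [set z | on_circle al be ga de z] =
    sph_section ((al - de) / m) (be / m) (ga / m) (- ((al + de) / m)).
  apply/seteqP; split=> X /=.
    by move=> [z /plane hz <-]; split=> //; exact: sphere_of_unit.
  move=> [/sphere_of_surj[z eX] hX]; exists z => //; apply/plane.
  by rewrite eX.
apply: (@sph_section_homeo _ _ _ _ _ (sphere_of (Some zs))).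
- by rewrite !expr_div_n -!mulrDl -m2 divff // expf_neq0.
- rewrite sqrrN expr_div_n m2 ltr_pdivrMr // mul1r NE ltrDr //.
- by split; [exact: sphere_of_unit|exact/plane].
Qed.

(** For real t, n1 + i n2 is the numerator of the coordinate map and al^2 + t^2 the squared modulus
    of its denominator. Their squared moduli add up to W, a denominator on the sphere that never
    vanishes, even when the image is infinity. *)
Let n1 t := - al * x0 - t * y0 + l1.
Let n2 t := x0 * t - al * y0 + l2.
Let W t := al ^+ 2 + t ^+ 2 + (n1 t ^+ 2 + n2 t ^+ 2).

Lemma W_gt0 t : 0 < W t.
Proof.
rewrite lt_neqAle !addr_ge0 ?sqr_ge0 // andbT eq_sym /W.
rewrite !paddr_eq0 ?addr_ge0 ?sqr_ge0 // !expf_eq0 /=.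
apply/negP => /andP[/andP[/eqP a0 /eqP t0]] /andP[/eqP e1 /eqP e2].
have h1 : l1 = 0.
  transitivity (n1 t + al * x0 + t * y0); first by rewrite /n1; ring.
  by rewrite e1 a0 t0 !mul0r !addr0.
have h2 : l2 = 0.
  transitivity (n2 t + al * y0 - t * x0); first by rewrite /n2; ring.
  by rewrite e2 a0 t0 !mul0r addr0 subr0.
by have := lam_gt0 discr zs_circ; rewrite h1 h2 !expr0n addr0 ltxx.
Qed.

Lemma sphere_mob t : sphere_of (mob (Complex t 0)) =
  ((n1 t ^+ 2 + n2 t ^+ 2 - (al ^+ 2 + t ^+ 2)) / W t,
   2 * (n2 t * t - n1 t * al) / W t, - (2 * (n1 t * t + n2 t * al) / W t)).
Proof.
have W0 := W_gt0 t; rewrite mobE oppr0 sub0r /=; case: ifP => [|h].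
  rewrite oppr_eq0 => /andP[/eqP a0 /eqP t0].
  move: W0; rewrite /W a0 t0 !expr0n !add0r subr0 !mulr0 subrr addr0 mulr0 !mul0r oppr0 => W0.
  by rewrite divff // gt_eqF.
have d0 : 0 < al ^+ 2 + t ^+ 2.
  rewrite lt_neqAle addr_ge0 ?sqr_ge0 // andbT eq_sym.
  rewrite paddr_eq0 ?sqr_ge0 // !expf_eq0 /=.
  by apply: contraFN h => /andP[/eqP -> ->]; rewrite oppr0 eqxx.
rewrite sqrrN /=.
have -> : x0 + (l1 * - al + l2 * t) / (al ^+ 2 + t ^+ 2) =
    (n2 t * t - n1 t * al) / (al ^+ 2 + t ^+ 2).
  by rewrite /n1 /n2; field; rewrite gt_eqF.
have -> : y0 + (l2 * - al - l1 * t) / (al ^+ 2 + t ^+ 2) =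
    - (n1 t * t + n2 t * al) / (al ^+ 2 + t ^+ 2).
  by rewrite /n1 /n2; field; rewrite gt_eqF.
have nn : ((n2 t * t - n1 t * al) / (al ^+ 2 + t ^+ 2)) ^+ 2 +
   (- (n1 t * t + n2 t * al) / (al ^+ 2 + t ^+ 2)) ^+ 2 =
   (n1 t ^+ 2 + n2 t ^+ 2) / (al ^+ 2 + t ^+ 2).
  by move: (n1 t) (n2 t) => u v; field; rewrite gt_eqF.
rewrite nn; have nW : (n1 t ^+ 2 + n2 t ^+ 2) / (al ^+ 2 + t ^+ 2) + 1 = W t / (al ^+ 2 + t ^+ 2).
  by rewrite /W; move: (n1 t) (n2 t) => u v; field; rewrite gt_eqF.
rewrite nW; move: W0; move: (W t) (n1 t) (n2 t) => w u v w0.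
by congr (_, _, _); field; rewrite !gt_eqF.
Qed.

(* The quotient num / den inverts the parametrisation t |-> mob t. *)
Let num := affine3 (l2 * x0 - l1 * y0) l2 (- l1) (l1 * y0 - l2 * x0).
Let den := affine3 (1 - (x0 ^+ 2 + y0 ^+ 2)) (- (2 * x0)) (- (2 * y0)) (1 + (x0 ^+ 2 + y0 ^+ 2)).

(** At the image of z, [den] is 2 |z - zs|^2 / (|z|^2 + 1) and [num] is 2 Im(lam conj(z - zs)) /
    (|z|^2 + 1), with lam = lam1 + i lam2. Since z - zs = lam / (i t - al) with t real, their
    quotient is t. *)
Lemma den_mob t : den (sphere_of (mob (Complex t 0))) = 2 * (l1 ^+ 2 + l2 ^+ 2) / W t.
Proof.
have W0 : W t != 0 by rewrite gt_eqF ?W_gt0.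
rewrite sphere_mob /den /affine3 /=; apply: (mulIf W0); rewrite divfK //.
transitivity (2 * (n1 t ^+ 2 + n2 t ^+ 2) + 2 * (x0 ^+ 2 + y0 ^+ 2) * (al ^+ 2 + t ^+ 2)
  - 4 * x0 * (n2 t * t - n1 t * al) + 4 * y0 * (n1 t * t + n2 t * al)).
  move: (erefl (W t)); rewrite {1}/W; move: (W t) W0 (n1 t) (n2 t) => w w0 u v e.
  move: w0; have -> : w = al ^+ 2 + t ^+ 2 + (u ^+ 2 + v ^+ 2) by rewrite -e.
  by move=> w0; field.
by rewrite /n1 /n2; ring.
Qed.

Lemma num_mob t : num (sphere_of (mob (Complex t 0))) = t * (2 * (l1 ^+ 2 + l2 ^+ 2) / W t).
Proof.
have W0 : W t != 0 by rewrite gt_eqF ?W_gt0.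
rewrite sphere_mob /num /affine3 /=; apply: (mulIf W0); rewrite -[RHS]mulrA divfK //.
transitivity (2 * (l1 * y0 - l2 * x0) * (al ^+ 2 + t ^+ 2)
  + 2 * l2 * (n2 t * t - n1 t * al) + 2 * l1 * (n1 t * t + n2 t * al)).
  move: (erefl (W t)); rewrite {1}/W; move: (W t) W0 (n1 t) (n2 t) => w w0 u v e.
  move: w0; have -> : w = al ^+ 2 + t ^+ 2 + (u ^+ 2 + v ^+ 2) by rewrite -e.
  by move=> w0; field.
by rewrite /n1 /n2; ring.
Qed.

Lemma segment_homeo t0 t1 : t0 < t1 ->
  CP1_homeomorphic [set z | exists t, t0 <= t <= t1 /\ z = mob (Complex t 0)]
    (@unit_segment R).
Proof.
move=> t01; have d0 : 0 < t1 - t0 by rewrite subr_gt0.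
pose T s := t0 + s * (t1 - t0).
pose f (X : R3 R) := (num X / den X - t0) / (t1 - t0).
pose g s : R3 R := sphere_of (mob (Complex (T s) 0)).
have L0 : 0 < 2 * (l1 ^+ 2 + l2 ^+ 2) by rewrite mulr_gt0 // (lam_gt0 discr zs_circ).
have den_gt0 t : 0 < den (sphere_of (mob (Complex t 0))).
  by rewrite den_mob divr_gt0 // W_gt0.
have quot t : num (sphere_of (mob (Complex t 0))) / den (sphere_of (mob (Complex t 0))) = t.
  by rewrite num_mob -den_mob mulfK // gt_eqF.
have fT t : T (f (sphere_of (mob (Complex t 0)))) = t.
  by rewrite /T /f quot divfK ?gt_eqF // addrC subrK.
apply: (@homeomorphic_image (R3 R) R _ _ f g).
- move=> X /= [z [t [ht ->]] <-]; split; last by rewrite /g fT.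
  rewrite /unit_segment /= in_itv /= /f quot.
  rewrite divr_ge0 ?subr_ge0 ?(ltW t01) //=; last by case/andP: ht.
  by rewrite ler_pdivrMr // mul1r lerD2r; case/andP: ht.
- move=> s; rewrite /unit_segment /= in_itv /= => /andP[s0 s1]; split.
    exists (mob (Complex (T s) 0)) => //; exists (T s); split=> //.
    rewrite /T lerDl mulr_ge0 ?(ltW d0) //= -lerBrDl.
    by rewrite -[leRHS]mul1r ler_wpM2r // ltW.
  rewrite /f /g quot /T addrC addKr mulfK ?gt_eqF //.
- move=> X /= [z [t [_ ->]] <-]; set X0 := sphere_of _.
  apply: cvgM; last exact: cvg_cst.
  apply: cvgB; last exact: cvg_cst.
  apply: cvgM; first exact: affine3_continuous.
  apply: cvgV; last exact: affine3_continuous. by rewrite gt_eqF // /X0 ?den_gt0.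
move=> s _.
have cT : {for s, continuous T}.
  by apply: cvgD; [exact: cvg_cst|apply: cvgM; [exact: cvg_id|exact: cvg_cst]].
have cn1 : {for s, continuous (n1 \o T)}.
  apply: cvgD; last exact: cvg_cst.
  by apply: cvgB; [exact: cvg_cst|apply: cvgM; [exact: cT|exact: cvg_cst]].
have cn2 : {for s, continuous (n2 \o T)}.
  apply: cvgD; last exact: cvg_cst.
  by apply: cvgB; [apply: cvgM; [exact: cvg_cst|exact: cT]|exact: cvg_cst].
have cX (u : R -> R) : {for s, continuous u} -> {for s, continuous (fun x => u x ^+ 2)}.
  by move=> cu; apply: cvgM; exact: cu.
have cd : {for s, continuous (fun x => al ^+ 2 + T x ^+ 2)}.
  by apply: cvgD; [exact: cvg_cst|exact: cX].
have cn : {for s, continuous (fun x => n1 (T x) ^+ 2 + n2 (T x) ^+ 2)}.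
  by apply: cvgD; exact: cX.
have cW : {for s, continuous (fun x => (W (T x))^-1)}.
  by apply: cvgV; [rewrite gt_eqF // W_gt0|apply: cvgD; [exact: cd|exact: cn]].
have -> : g = (fun x => ((n1 (T x) ^+ 2 + n2 (T x) ^+ 2 - (al ^+ 2 + T x ^+ 2)) / W (T x),
   2 * (n2 (T x) * T x - n1 (T x) * al) / W (T x),
   - (2 * (n1 (T x) * T x + n2 (T x) * al) / W (T x)))).
  by apply/funext => x; rewrite /g sphere_mob.
apply: (@continuous_pair _ (R * R)%type R).
  apply: continuous_pair.
    by apply: cvgM; [apply: cvgB; [exact: cn|exact: cd]|exact: cW].
  apply: cvgM; last exact: cW.
  apply: cvgM; first exact: cvg_cst.
  apply: cvgB; apply: cvgM; [exact: cn2|exact: cT|exact: cn1|exact: cvg_cst].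
apply: cvgN; apply: cvgM; last exact: cW.
apply: cvgM; first exact: cvg_cst.
apply: cvgD; apply: cvgM; [exact: cn1|exact: cT|exact: cn2|exact: cvg_cst].
Qed.

End SphericalCurves.

(** * Conclusion *)

Lemma proportional_cross (F : comNzRingType) (k c u v x y : F) :
  k * u = c * x -> k * v = c * y -> k * c * (x * v) = k * c * (u * y).
Proof.
move=> ex ey; transitivity ((k * v) * (c * x)); first by ring.
by rewrite -ex ey; ring.
Qed.

Section Coordinate.
Variable R : realType.
Local Notation C := R[i].
Local Notation toC := (real_complex R).
Local Notation Re := (@complex.Re R).
Local Notation Im := (@complex.Im R).

Lemma hcomp_neq0 (a b c d : C) n (r : {poly C}) : c != 0 -> a * d - b * c != 0 ->
  (size r <= n.+1)%N -> r != 0 -> hcomp n r (a *: 'X + b%:P) (c *: 'X + d%:P) != 0.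
Proof.
move=> c0 det0 sr r0; have /closed_nonrootP[z] : r * ('X - (a / c)%:P) != 0.
  by rewrite mulf_neq0 ?polyXsubC_eq0.
rewrite rootM negb_or root_XsubC => /andP[rz zs].
have [|t et] := @mobius_surj R a b c d (Some z) c0 det0.
  by move=> [e]; rewrite e eqxx in zs.
apply/closed_nonrootP; exists t.
by rewrite (root_hcomp det0) // et.
Qed.

Lemma exists_root_top (r : {poly C}) n : (0 < n)%N -> r`_n != 0 ->
  exists z, root r z.
Proof.
move=> n0 rn; apply/closed_rootP; apply: contra rn => /eqP s1.
by rewrite nth_default // s1.
Qed.

(** A generic fibre over c in (-1, 1) is nonempty, finite in the plane and off the roots of T. *)
Lemma zdense_support (b : ratfun R) : rf_wf b -> (0 < rf_deg b)%N ->
  zdense [set z | dessin_support b (Some z)].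
Proof.
move=> wf deg T T0.
have lt11 : -1 < 1 :> R by lra.
have [c [/andP[c1 c2] top hc]] :=
  generic_fiber (num_den_noroot wf) (num_den_top deg) T0 lt11.
have [z rz] := exists_root_top deg top.
exists z; last exact: hc.
exists c; split; first by rewrite !ltW.
by apply/(rf_evalP wf deg (Some z)).
Qed.

Variables (al be ga de x0 y0 : R) (b : ratfun R) (G : {poly C}).
Local Notation zs := (Complex x0 y0).
Hypotheses (wf : rf_wf b) (deg : (0 < rf_deg b)%N).
Hypothesis discr : 0 < be ^+ 2 + ga ^+ 2 - 4 * al * de.
Hypothesis zs_circ : circle_eq al be ga de zs.
Hypotheses (G0 : G != 0) (hG : forall z, dessin_support b (Some z) ->
  ~~ root G z -> circle_eq al be ga de z).
Local Notation mob := (mobius (mob_a x0 y0) (mob_b al be ga x0 y0) (mob_c R) (mob_d al)).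
Local Notation N := (mob_a x0 y0 *: 'X + (mob_b al be ga x0 y0)%:P).
Local Notation D := (mob_c R *: 'X + (mob_d al)%:P).
Local Notation n := (rf_deg b).
Local Notation p' := (hcomp n (rf_num b) N D).
Local Notation q' := (hcomp n (rf_den b) N D).
Let c0 := mob_c_neq0 R.
Let det0 := mob_det_neq0 discr zs_circ.
Let cpq := coprimep_hcomp det0 wf deg.

Lemma support_mob t : dessin_support b (mob t) <->
  exists c : R, -1 <= c <= 1 /\ root (p' - toC c *: q') t.
Proof.
by split=> -[c [hc e]]; exists c; split=> //; apply/(rf_eval_mobius det0 wf deg).
Qed.

Lemma mob_D_neq0 : D != 0.
Proof.
apply: contraNneq c0 => /(congr1 (fun r : {poly C} => r`_1)).
by rewrite coefD coefZ coefX coefC mulr1 addr0 coef0 => ->.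
Qed.

Lemma size_num_hcomp : (size p' <= n.+1)%N.
Proof. by have [] := hcomp_top c0 det0 (size_num_le b). Qed.

Lemma size_den_hcomp : (size q' <= n.+1)%N.
Proof. by have [] := hcomp_top c0 det0 (size_den_le b). Qed.

Lemma num_hcomp_top : p'`_n = mob_c R ^+ n * (rf_num b).[zs].
Proof.
have [_ ->] := hcomp_top c0 det0 (size_num_le b).
by rewrite mob_center.
Qed.

Lemma den_hcomp_top : q'`_n = mob_c R ^+ n * (rf_den b).[zs].
Proof.
have [_ ->] := hcomp_top c0 det0 (size_den_le b).
by rewrite mob_center.
Qed.

Lemma hcomp_noroot x : root p' x -> ~~ root q' x.
Proof. exact: (coprimep_noroot _ _ cpq). Qed.

Lemma hcomp_top_neq0 : p'`_n = 0 -> q'`_n != 0.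
Proof.
rewrite num_hcomp_top den_hcomp_top => /eqP.
rewrite mulf_eq0 expf_eq0 (negPf c0) andbF /= => pz.
by rewrite mulf_neq0 ?expf_neq0 //; exact: (num_den_noroot wf).
Qed.

Lemma fiber_real (c : R) t : -1 <= c <= 1 -> root (p' - toC c *: q') t -> Im t = 0.
Proof.
(* The exceptional parameters are those sent to infinity or to a root of G. *)
have T0 : D * hcomp (size G) G N D != 0.
  by rewrite mulf_neq0 ?mob_D_neq0 // hcomp_neq0.
apply: (real_rooted_limit size_num_hcomp size_den_hcomp hcomp_noroot hcomp_top_neq0 _ T0).
  by move=> k; rewrite -hcompB hcomp_neq0 ?size_fiber_le // fiber_neq0.
move=> {}c {}t hc rt; rewrite rootM negb_or => /andP[Dt].
rewrite (root_hcomp det0) // => Gt; apply/(on_circle_mob discr zs_circ).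
have : dessin_support b (mob t) by apply/support_mob; exists c.
move: Gt; rewrite /mobius -rootE Dt /= => Gt Kt.
exact: hG.
Qed.

Lemma support_on_circle z : dessin_support b z -> on_circle al be ga de z.
Proof.
have [->|zN] := pselect (z = Some zs); first by [].
have [|t et] := @mobius_surj R _ (mob_b al be ga x0 y0) _ (mob_d al) z c0 det0.
  by rewrite mob_center.
rewrite -et => /support_mob[c [hc rt]].
by apply/(on_circle_mob discr zs_circ); exact: fiber_real rt.
Qed.

Lemma real_model : exists k (pr qr : {poly R}),
  [/\ k != 0, p' = k *: map_poly toC pr & q' = k *: map_poly toC qr].
Proof.
apply: real_scaling => //.
  by rewrite hcomp_neq0 ?size_den_le //; case: wf.
move=> T T0; have lt11 : -1 < 1 :> R by lra.
have [c [/andP[c1 c2] top hc]] := generic_fiber hcomp_noroot hcomp_top_neq0 T0 lt11.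
have [t rt] := exists_root_top deg top; exists t; last exact: hc.
split; last by exists c.
by apply: fiber_real rt; rewrite !ltW.
Qed.

Section Model.
Variables (k : C) (pr qr : {poly R}).
Hypotheses (k0 : k != 0) (ep : p' = k *: map_poly toC pr)
  (eq : q' = k *: map_poly toC qr).
Local Notation P := (map_poly toC pr).
Local Notation Q := (map_poly toC qr).

Lemma coprimep_model : coprimep P Q.
Proof. by have := cpq; rewrite ep eq coprimepZl // coprimepZr. Qed.

Lemma support_model t : dessin_support b (mob (toC t)) <-> pr.[t] ^+ 2 <= qr.[t] ^+ 2.
Proof.
have rootE' c : root (p' - toC c *: q') (toC t) <-> pr.[t] = c * qr.[t].
  rewrite ep eq scalerA [toC c * k]mulrC -scalerA -scalerBr rootZ //.
  rewrite rootE hornerD hornerN hornerZ !horner_map -rmorphM -rmorphB /=.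
  rewrite -[0]/(toC 0) (inj_eq (@complexI R)) subr_eq0.
  by split=> [/eqP|->].
rewrite support_mob; split=> [[c [/andP[c1 c2] /rootE' ->]]|h].
  rewrite exprMn -[leRHS]mul1r ler_wpM2r ?sqr_ge0 //.
  by rewrite -real_normK ?num_real // expr_le1 // ler_norml c1.
have q0 : qr.[t] != 0.
  apply/eqP => q0; move: h; rewrite q0 expr0n => h.
  have p0 : pr.[t] = 0.
    by apply/eqP; rewrite -sqrf_eq0 eq_le h sqr_ge0.
  have := coprimep_noroot _ _ coprimep_model (toC t).
  by rewrite !rootE !horner_map p0 q0 /= eqxx => /(_ isT).
exists (pr.[t] / qr.[t]); split; last by apply/rootE'; rewrite divfK.
rewrite -ler_norml -[1](@normr1 R) -ler_sqr ?nnegrE //.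
by rewrite !real_normK ?num_real // expr1n expr_div_n ler_pdivrMr ?exprn_even_gt0 // mul1r.
Qed.

End Model.

Lemma on_circle_surj z : on_circle al be ga de z -> z <> Some zs ->
  exists t : R, z = mob (toC t).
Proof.
move=> hz zN; have [|t et] := @mobius_surj R _ (mob_b al be ga x0 y0) _ (mob_d al) z c0 det0.
  by rewrite mob_center.
have := on_circle_mob discr zs_circ t; rewrite et => /iffLR/(_ hz).
by move: et; case: t => s tau <- /= ->; exists s.
Qed.

(* A generic point of the circle off the support, to be sent to infinity. *)
Lemma exists_generic_center z1 : dessin_support b (Some zs) ->
  on_circle al be ga de z1 -> ~ dessin_support b z1 ->
  exists z, [/\ circle_eq al be ga de z, ~ dessin_support b (Some z) &
    ~~ root (rf_den b) z].
Proof.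
move=> Kzs z1c Kz1; have [|t1 et1] := on_circle_surj z1c.
  by move=> e; apply: Kz1; rewrite e.
have [k [pr [qr [k0 ep eq]]]] := real_model.
have suppE := support_model k0 ep eq.
pose A := (pr - qr) * (pr + qr).
have AE t : 0 < A.[t] -> ~ dessin_support b (mob (toC t)).
  by rewrite horner_sqrB subr_gt0 => h /suppE; rewrite leNgt h.
have A1 : 0 < A.[t1].
  rewrite horner_sqrB subr_gt0 ltNge; apply/negP => h.
  by apply: Kz1; rewrite et1; apply/suppE.
have /nbhs_ballP[e /= e0 he] : \forall t \near t1, 0 < A.[t].
  exact: (cvgr_gt _ (@continuous_horner R A t1) _ A1).
(* Positivity of A persists near t1, which leaves room to avoid parameters sent to infinity or to a
   pole. *)
have T0 : D * q' != 0 by rewrite mulf_neq0 ?mob_D_neq0 // hcomp_neq0 ?size_den_le //; case: wf.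
have lt1 : t1 < t1 + e by rewrite ltrDl.
have [t /andP[ht1 hte]] := exists_real_nonroot T0 lt1.
rewrite rootM negb_or => /andP[Dt qt].
have At : 0 < A.[t].
  by apply: he; rewrite /ball /= ltr0_norm ?subr_lt0 // opprB ltrBlDl.
move: (AE _ At) qt; rewrite (root_hcomp det0) ?size_den_le //.
have := on_circle_mob discr zs_circ (toC t) => /iffRL/(_ (erefl _)).
rewrite /mobius -rootE Dt /= => zc Kz qz.
by exists (N.[toC t] / D.[toC t]).
Qed.

(** With [zs] off the support and not a pole, the real model meets the hypotheses of
    [real_interval]: each condition at infinity translates one at [zs]. *)
Lemma support_segment : belyi b -> ~ dessin_support b (Some zs) ->
  ~~ root (rf_den b) zs -> is_segment b.
Proof.
move=> [_ [_ ram]] Kzs qz.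
have [k [pr [qr [k0 ep eq]]]] := real_model.
have suppE := support_model k0 ep eq.
have cPQ := coprimep_model k0 ep eq.
have sZ (r : {poly R}) : size (k *: map_poly toC r) = size r.
  by rewrite size_scale // size_map_poly.
have sp : (size pr <= n.+1)%N by rewrite -sZ -ep size_num_hcomp.
have pn : k * toC pr`_n = mob_c R ^+ n * (rf_num b).[zs].
  by rewrite -num_hcomp_top ep coefZ coef_map.
have qn : k * toC qr`_n = mob_c R ^+ n * (rf_den b).[zs].
  by rewrite -den_hcomp_top eq coefZ coef_map.
have cn0 : mob_c R ^+ n != 0 by rewrite expf_neq0.
have qn0 : qr`_n != 0.
  apply/eqP => q0; move/eqP: qn; rewrite q0 mulr0 eq_sym mulf_eq0 (negPf cn0) /=.
  by rewrite -rootE (negPf qz).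
have sq : size qr = n.+1.
  apply/eqP; rewrite eqn_leq -{1}sZ -eq size_den_hcomp ltnNge.
  by apply/negP => /leq_sizeP h; rewrite h ?eqxx in qn0.
have support_zs (c : R) : -1 <= c <= 1 -> rf_eval b (Some zs) = Some (toC c) -> False.
  by move=> hc e; apply: Kzs; exists c.
have ev_zs : rf_eval b (Some zs) = Some ((rf_num b).[zs] / (rf_den b).[zs]).
  by rewrite /= -rootE qz.
(* The value of b at [zs] is the real number pr_n / qr_n; if it lay in [-1, 1], [zs] would be in the
   support. *)
have lt_pq : qr`_n ^+ 2 < pr`_n ^+ 2.
  rewrite ltNge; apply/negP => h; apply: (support_zs (pr`_n / qr`_n)).
    rewrite -ler_norml -[1](@normr1 R) -ler_sqr ?nnegrE //.
    by rewrite !real_normK ?num_real // expr1n expr_div_n ler_pdivrMr ?exprn_even_gt0 // mul1r.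
  rewrite ev_zs fmorph_div; congr Some; apply/eqP; rewrite eqr_div -?rootE //; last first.
    by rewrite fmorph_eq0.
  have kc0 : k * mob_c R ^+ n != 0 by rewrite mulf_neq0.
  by apply/eqP/(mulfI kc0); exact: proportional_cross pn qn.
(* The critical values 1 and -1 lie in [-1, 1], excluded at [zs], and infinity is excluded because
   [zs] is not a pole. *)
have noncrit : ~ critical_point b (Some zs).
  move=> /ram; rewrite ev_zs !inE => /or3P[/eqP e|/eqP e|//].
    by apply: (support_zs 1); [apply/andP; split; lra|rewrite ev_zs e].
  apply: (support_zs (-1)); [by apply/andP; split; lra|rewrite ev_zs e].
  by rewrite rmorphN.
have eW : wronsk p' q' = (k * k) *: wronsk (map_poly toC pr) (map_poly toC qr).
  by rewrite ep eq wronskZ.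
have sW : size (wronsk (map_poly toC pr) (map_poly toC qr)) = (n.*2).-1.
  have := size_wronsk_hcomp c0 det0 wf deg; rewrite mob_center => /(_ qz noncrit).
  by rewrite eW size_scale // mulf_neq0.
have preal t : root (map_poly toC pr) t -> Im t = 0.
  move=> pt; apply: (@fiber_real 0); first by apply/andP; split; lra.
  by rewrite ep scale0r subr0 rootZ.
have unram t : root (wronsk (map_poly toC pr) (map_poly toC qr)) t ->
    ~~ root (map_poly toC qr) t ->
    root ((map_poly toC pr - map_poly toC qr) * (map_poly toC pr + map_poly toC qr)) t.
  move=> Wt qt; have : critical_point b (mob t).
    apply: (wronsk_hcomp_critical c0 det0 wf deg); first by rewrite eW rootZ // mulf_neq0.
    by rewrite eq rootZ.
  move=> /ram; have -> : rf_eval b (mob t) =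
      Some ((map_poly toC pr).[t] / (map_poly toC qr).[t]).
    apply/(rf_eval_mobius det0 wf deg); rewrite ep eq scalerA mulrC -scalerA -scalerBr rootZ //.
    by rewrite rootE hornerD hornerN hornerZ divfK // subrr.
  rewrite !inE rootE hornerM hornerD hornerN hornerD mulf_eq0 subr_eq0 addr_eq0.
  move=> /or3P[/eqP[e]|/eqP[e]|//]; apply/orP; [left|right].
    by rewrite -[eqbRHS]mul1r -e divfK.
  by rewrite -[eqbRHS]mulN1r -e divfK.
have [t0 [t1 [t01 ht]]] := real_interval deg cPQ sp sq lt_pq preal sW unram.
rewrite /is_segment.
have -> : dessin_support b = [set z | exists t, t0 <= t <= t1 /\ z = mob (toC t)].
  apply/seteqP; split=> z /=.
    move=> Kz; have [t et] := on_circle_surj (support_on_circle Kz) (fun e => Kzs (eq_ind z (dessin_support b) Kz _ e)).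
    by exists t; split=> //; rewrite -ht; apply/suppE; rewrite -et.
  by move=> [t [h ->]]; apply/suppE; rewrite ht.
exact: (segment_homeo discr zs_circ t01).
Qed.

End Coordinate.

Theorem theorem1 (R : realType) (b1 b2 : ratfun R) :
  belyi b1 -> belyi b2 ->
  dessin_support b1 = dessin_support b2 ->
  generate_Cz b1 b2 ->
  (is_segment b1 /\ is_segment b2) \/ (is_circle b1 /\ is_circle b2).
Proof.
move=> B1 B2 K12 gen; have [wf1 [deg1 _]] := B1; have [wf2 _] := B2.
rewrite /is_segment /is_circle -K12.
(* Both properties depend on the common support alone. *)
suff [h|h] : is_segment b1 \/ is_circle b1 by [left|right].
have [N [D [G [G0 hG]]]] := schwarz_function wf1 wf2 gen.
pose S := [set z | dessin_support b1 (Some z) /\ ~~ root G z].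
have dS : zdense S.
  move=> T T0; have [z Kz] := zdense_support wf1 deg1 (mulf_neq0 T0 G0).
  by rewrite rootM negb_or => /andP[Tz Gz]; exists z.
have hS z : S z -> D.[z] != 0 /\ conjc z * D.[z] = N.[z].
  move=> [Kz Gz]; have [x [_ ex]] := Kz.
  have [y [_ ey]] : dessin_support b2 (Some z) by rewrite -K12.
  exact: hG Gz ex ey.
have [al [be [ga [de [discr hc]]]]] := schwarz_circle dS hS.
have hC z : dessin_support b1 (Some z) -> ~~ root G z -> circle_eq al be ga de z.
  by move=> Kz Gz; exact: hc.
(* First centre: any generic point of the support, known to lie on the circle. *)
have [[x0 y0] S0 _] := dS 1 (oner_neq0 _).
have z0c := hc _ S0.
have Kc z := support_on_circle wf1 deg1 discr z0c G0 hC (z := z).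
have [all_K|] := pselect (forall z, on_circle al be ga de z -> dessin_support b1 z).
  right; rewrite /is_circle.
  have -> : dessin_support b1 = [set z | on_circle al be ga de z].
    by apply/seteqP; split=> z; [exact: Kc|exact: all_K].
  exact: circle_homeo z0c.
move=> /existsNP[z1 /not_implyP[z1c Kz1]]; left.
(* Second centre: off the support and not a pole, so that the segment argument applies. *)
have [[x1 y1] [zc Kz qz]] := exists_generic_center wf1 deg1 discr z0c G0 hC S0.1 z1c Kz1.
exact: (support_segment wf1 deg1 discr zc G0 hC).
Qed.
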